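(* Let $n\ge1$, let $G$ be a Dedekind $\sigma$-complete $\ell$-group, let $M=\Gamma(\mathbb Z\,\overrightarrow{\times}\,G,(1,0))$, and let $F:\mathbb R^n\to M$ be an $n$-dimensional spectral resolution on $M$. Then there is a unique $n$-dimensional observable $x$ on $M$ such that $x((-\infty,t_1)\times\cdots\times(-\infty,t_n))=F(t_1,\ldots,t_n)$ for all $(t_1,\ldots,t_n)\in\mathbb R^n$.
   Context: All groups are Abelian and written additively. An $\ell$-group $G$ is Dedekind $\sigma$-complete if every nonempty countable subset of $G$ bounded above has a supremum in $G$. $\mathbb Z\,\overrightarrow{\times}\,G$ is the group $\mathbb Z\times G$ with lexicographic order: $(m,g)\le(m',g')$ iff $m<m'$, or $m=m'$ and $g\le g'$. $\Gamma(\mathbb Z\,\overrightarrow{\times}\,G,(1,0))$ is the interval $[(0,0),(1,0)]$ with its usual MV-algebra structure ($a\oplus b=(a+b)\wedge(1,0)$, $a'=(1,0)-a$); bottom $0=(0,0)$, top $1=(1,0)$. The partial addition $a+b$ on $M$ is the group sum, defined when it is $\le(1,0)$. $\mathrm{Rad}(M)=\{(0,g):g\ge 0\}$ and $\mathrm{Rad}(M)'=\{(1,-g): g\ge0\}$; $M$ is their disjoint union. Suprema and infima below are taken in $M$. For $s,t\in\mathbb R^n$, $s\ll t$ (equivalently $t\gg s$) means $s_i<t_i$ for all $i=1,\ldots,n$. For $F:\mathbb R^n\to M$ and reals $a\le b$, $\Delta_i(a,b)F$ is the function of the remaining variables $F(\ldots,t_{i-1},b,t_{i+1},\ldots)-F(\ldots,t_{i-1},a,t_{i+1},\ldots)$,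 computed in $\mathbb Z\,\overrightarrow{\times}\,G$. An $n$-dimensional spectral resolution on $M$ is a map $F:\mathbb R^n\to M$ such that: (i) (volume condition) $\Delta_1(a_1,b_1)\cdots\Delta_n(a_n,b_n)F\ge0$ for all reals $a_i\le b_i$, $i=1,\ldots,n$; (ii) $\bigvee_{s\ll t}F(s)=F(t)$ for all $t\in\mathbb R^n$; (iii) $\bigwedge_{t_i\in\mathbb R}F(s_1,\ldots,s_{i-1},t_i,s_{i+1},\ldots,s_n)=0$ for each $i$ and all fixed values of the other variables; (iv) $\bigvee_{s\in\mathbb R^n}F(s)=1$; (v) if $\mathbf t_0=(t^0_1,\ldots,t^0_n)$ denotes the characteristic point of $F$, i.e. the coordinatewise infimum of $T_1=\{t\in\mathbb R^n: F(t)\in\mathrm{Rad}(M)'\}$, then $\bigwedge\{F(s): s\gg\mathbf t_0\}$ exists in $M$ and belongs to $\mathrm{Rad}(M)'$. An $n$-dimensional observable on $M$ is a map $x:\mathcal B(\mathbb R^n)\to M$ on the Borel $\sigma$-algebra such that $x(\mathbb R^n)=1$; $x(A\cup B)=x(A)+x(B)$ (the sum being defined in $M$) for disjoint Borel sets $A,B$; and $x(\bigcup_iA_i)=\bigvee_i x(A_i)$ for every non-decreasing sequence $(A_i)_i$ of Borel sets. *)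

(* Defs.v *)
From HB Require Import structures.
From mathcomp Require Import all_boot all_order all_algebra.
From mathcomp Require Import all_classical all_reals all_analysis.
Import Order.TTheory GRing.Theory Num.Theory numFieldNormedType.Exports.

Set Implicit Arguments.
Unset Strict Implicit.
Unset Printing Implicit Defensive.

Local Open Scope classical_set_scope.
Local Open Scope ring_scope.

(** Abelian lattice-ordered groups. The lattice operations are fields of the
    mixin because HB does not allow joining [Order.Lattice] with the group
    hierarchy below the existing [Num.RealDomain]. *)

HB.mixin Record POrderedZmodule_isLGroup G & Num.POrderedZmodule G := {
  lmeet : G -> G -> G ;
  ljoin : G -> G -> G ;
  le_lmeet : forall z x y : G, (z <= lmeet x y) = (z <= x) && (z <= y) ;
  ljoin_le : forall x y z : G, (ljoin x y <= z) = (x <= z) && (y <= z) ;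
  lgroup_leD2l : forall z x y : G, x <= y -> z + x <= z + y
}.

#[short(type="lgroupType")]
HB.structure Definition LGroup :=
  { G of Num.POrderedZmodule G & POrderedZmodule_isLGroup G }.

Definition dedekind_sigma_complete (G : lgroupType) : Prop :=
  forall A : set G, countable A -> A !=set0 -> ubound A !=set0 ->
    supremums A !=set0.

Definition lexZ (G : lgroupType) : Type := (int *lexi[ring_display] G)%type.

HB.instance Definition _ (G : lgroupType) :=
  Order.POrder.copy (lexZ G) (int *lexi[ring_display] G)%type.
HB.instance Definition _ (G : lgroupType) :=
  GRing.Zmodule.copy (lexZ G) (int * G)%type.

Lemma lexZ_leE (G : lgroupType) (x y : lexZ G) :
  (x <= y) = (x.1 < y.1) || ((x.1 == y.1) && (x.2 <= y.2)).
Proof.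
by rewrite [LHS]/Order.le /= /Order.ProdLexiOrder.le; case: (ltgtP x.1 y.1).
Qed.

Definition lexZ_unit (G : lgroupType) : lexZ G := (1 : int, 0 : G).

Record Gamma (G : lgroupType) : Type := MkGamma {
  Gamma_val :> lexZ G ;
  Gamma_valP : 0 <= Gamma_val <= lexZ_unit G
}.

HB.instance Definition _ (G : lgroupType) := [isSub for @Gamma_val G].
HB.instance Definition _ (G : lgroupType) := [Choice of Gamma G by <:].
HB.instance Definition _ (G : lgroupType) :=
  [SubChoice_isSubPOrder of Gamma G by <: with ring_display].

Lemma lexZ_unit_ge0 (G : lgroupType) : 0 <= lexZ_unit G.
Proof. by rewrite lexZ_leE. Qed.

Lemma Gamma_bot_subproof (G : lgroupType) : 0 <= (0 : lexZ G) <= lexZ_unit G.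
Proof. by rewrite lexx lexZ_unit_ge0. Qed.

Lemma Gamma_top_subproof (G : lgroupType) :
  0 <= lexZ_unit G <= lexZ_unit G.
Proof. by rewrite lexx lexZ_unit_ge0. Qed.

Definition Gamma_bot (G : lgroupType) : Gamma G :=
  MkGamma (Gamma_bot_subproof G).
Definition Gamma_top (G : lgroupType) : Gamma G :=
  MkGamma (Gamma_top_subproof G).

(** Partial addition: [None] when the group sum leaves the interval. *)
Definition Gamma_padd (G : lgroupType) (a b : Gamma G) : option (Gamma G) :=
  insub (val a + val b).

Definition Rad' (G : lgroupType) : set (Gamma G) :=
  [set m | exists2 g : G, 0 <= g & val m = (1 : int, - g)].

Section SpectralResolution.
Context {R : realType} {n : nat} {G : lgroupType}.
Implicit Types (F : 'rV[R]_n -> Gamma G) (s t : 'rV[R]_n).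

Definition ll s t : Prop := forall i : 'I_n, s 0 i < t 0 i.

Definition upd t (i : 'I_n) (r : R) : 'rV[R]_n :=
  \row_j (if j == i then r else t 0 j).

(** The difference is kept as a function of all [n] variables; it does not
    depend on the [i]-th one. *)
Definition Delta (i : 'I_n) (a b : R) (f : 'rV[R]_n -> lexZ G) :
    'rV[R]_n -> lexZ G :=
  fun t => f (upd t i b) - f (upd t i a).

(** All variables are eliminated, so this is a constant function. *)
Definition volume F (a b : 'rV[R]_n) : 'rV[R]_n -> lexZ G :=
  foldr (fun i f => Delta i (a 0 i) (b 0 i) f) (fun t => val (F t))
    (enum 'I_n).

(** For a spectral resolution, [inf] is a genuine infimum: [sr_volume],
    [sr_bot] and [sr_top] below force the set of points sent to [Rad'] to be
    nonempty and bounded below in each coordinate. *)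
Definition char_point F : 'rV[R]_n :=
  \row_i inf [set t 0 i | t in F @^-1` @Rad' G].

Record spectral_resolution F : Prop := {
  sr_volume : forall a b : 'rV[R]_n, (forall i, a 0 i <= b 0 i) ->
    forall t, 0 <= volume F a b t ;
  sr_left : forall t, supremums [set F s | s in [set s | ll s t]] (F t) ;
  sr_bot : forall s (i : 'I_n),
    infimums [set F (upd s i r) | r in [set: R]] (Gamma_bot G) ;
  sr_top : supremums [set F s | s in [set: 'rV[R]_n]] (Gamma_top G) ;
  sr_char : exists2 m : Gamma G,
    infimums [set F s | s in [set s | ll (char_point F) s]] m & Rad' m
}.

End SpectralResolution.

Definition borel (R : realType) (n : nat) : set (set 'rV[R]_n) :=
  <<s [set A : set 'rV[R]_n | open A] >>.

(** As for measures in the library, an observable is a total function on sets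
    of which only the values on Borel sets matter. *)
Record observable (R : realType) (n : nat) (G : lgroupType)
    (x : set 'rV[R]_n -> Gamma G) : Prop := {
  obs_top : x [set: 'rV[R]_n] = Gamma_top G ;
  obs_add : forall A B, borel A -> borel B -> A `&` B = set0 ->
    Gamma_padd (x A) (x B) = Some (x (A `|` B)) ;
  obs_sup : forall A : nat -> set 'rV[R]_n, (forall k, borel (A k)) ->
    (forall k, A k `<=` A k.+1) ->
    supremums [set x (A k) | k in [set: nat]] (x (\bigcup_k A k))
}.

(* Main.v *)
From HB Require Import structures.
Require Import Defs.
From mathcomp Require Import all_boot all_order all_algebra.
From mathcomp Require Import all_classical all_reals all_analysis.
From mathcomp Require Import lra zify.
Import Order.TTheory GRing.Theory Num.Theory numFieldNormedType.Exports.

(** Write [F = (Z, f)] with [Z] integer valued. The set [Z = 1] is the open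
    orthant above the characteristic point [p], so that [F] is the distribution
    function of the unit mass at [p] plus a [G]-valued measure which is positive
    off [p]. Adding a large mass [u] at [p] turns [f] into the distribution
    function of a positive bounded [G]-valued measure [nu], and the observable
    is [(1, nu A - u)] if [p] is in [A] and [(0, nu A)] otherwise.

    Carathéodory's construction is not available for [G]-valued measures when
    [G] is not weakly distributive. Instead [G] is compared with the reals in the
    manner of Rasiowa and Sikorski: a decreasing sequence of positive elements of
    [G] meeting countably many prescribed dense sets defines a positive
    functional which is additive and preserves countably many prescribed suprema,
    and such functionals separate the points of [G]. A generic functional maps
    [nu] on rational orthants to a real distribution function, hence to a real
    Borel measure. The Borel sets [A] for which some [g] in [G] is mapped to the
    measure of [A] by every sufficiently generic functional form a
    lambda-system, and [nu A := g]. *)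

Set Implicit Arguments.
Unset Strict Implicit.
Unset Printing Implicit Defensive.

Local Open Scope classical_set_scope.
Local Open Scope ring_scope.

(** * Abelian lattice-ordered groups and generic sequences *)

(** A generic functional preserves only countably many prescribed suprema, while there are
    uncountably many Borel sets. The dense sets may therefore depend on the set under consideration,
    and each step combines only countably many requirements: values at rational points for
    distribution functions, one increasing sequence for a union. The value [nu A] is independent of
    these choices because generic functionals separate points, which rests on the Archimedean
    property that Dedekind completeness for countable sets provides. The mass [u] answers a second
    obstacle: in the lexicographic order a volume can be nonnegative merely because its integer part
    is positive, its [G]-part being negative. A large enough [u] exists once [f] is uniformly
    bounded. Above [p] the lower bound comes from the condition at the characteristic point; off
    that orthant the upper bound comes from supermodularity of [F]. *)

Section LGroupTheory.
Variable G : lgroupType.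
Implicit Types x y z t p w g h : G.

Lemma lg_leD2l z x y : (z + x <= z + y) = (x <= y).
Proof.
apply/idP/idP; last exact: lgroup_leD2l.
by move=> /(lgroup_leD2l (- z)); rewrite !addKr.
Qed.

Lemma lg_leD2r z x y : (x + z <= y + z) = (x <= y).
Proof. by rewrite ![_ + z]addrC lg_leD2l. Qed.

Lemma lg_subr_ge0 x y : (0 <= y - x) = (x <= y).
Proof. by rewrite -(lg_leD2r x 0) add0r subrK. Qed.

Lemma lg_leBlD x y z : (x - y <= z) = (x <= z + y).
Proof. by rewrite -(lg_leD2r y (x - y)) subrK. Qed.

Lemma lg_leBrD x y z : (x <= y - z) = (x + z <= y).
Proof. by rewrite -(lg_leD2r z x) subrK. Qed.

Lemma lg_leN2 x y : (- x <= - y) = (y <= x).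
Proof. by rewrite -(lg_subr_ge0 (- x)) opprK addrC lg_subr_ge0. Qed.

Lemma lg_oppr_le0 x : (- x <= 0) = (0 <= x).
Proof. by rewrite -[in LHS]oppr0 lg_leN2. Qed.

Lemma lg_oppr_ge0 x : (0 <= - x) = (x <= 0).
Proof. by rewrite -[in LHS]oppr0 lg_leN2. Qed.

Lemma lg_leD x y z t : x <= y -> z <= t -> x + z <= y + t.
Proof. by move=> xy zt; apply: (@le_trans _ _ (y + z)); rewrite ?lg_leD2l ?lg_leD2r. Qed.

Lemma lg_addr_ge0 x y : 0 <= x -> 0 <= y -> 0 <= x + y.
Proof. by move=> x0 y0; rewrite -(addr0 0); apply: lg_leD. Qed.

Lemma lg_leMn x y n : x <= y -> x *+ n <= y *+ n.
Proof. by move=> xy; elim: n => [|n IH]; rewrite ?mulr0n// !mulrS lg_leD. Qed.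

Lemma lg_mulrn_ge0 x n : 0 <= x -> 0 <= x *+ n.
Proof. by move=> /(@lg_leMn 0 x n); rewrite mul0rn. Qed.

Lemma lg_leMnr x m n : 0 <= x -> (m <= n)%N -> x *+ m <= x *+ n.
Proof.
move=> x0 mn; rewrite -(subnKC mn) mulrnDr -{1}(addr0 (x *+ m)) lg_leD2l.
exact: lg_mulrn_ge0.
Qed.

Lemma lg_leMz x (a b : int) : 0 <= x -> a <= b -> x *~ a <= x *~ b.
Proof.
move=> x0 ab; rewrite -lg_subr_ge0 -mulrzBr.
case: (b - a) (subr_ge0 a b) => [n _|n]; last by rewrite ab.
by rewrite -pmulrn lg_mulrn_ge0.
Qed.

Lemma ljoin_ge x y : (x <= ljoin x y) && (y <= ljoin x y).
Proof. by rewrite -ljoin_le. Qed.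

Lemma lmeet_le x y : (lmeet x y <= x) && (lmeet x y <= y).
Proof. by rewrite -le_lmeet. Qed.

Definition ppart x : G := ljoin x 0.

Lemma ppart_ge x : x <= ppart x. Proof. by case/andP: (ljoin_ge x 0). Qed.
Lemma ppart_ge0 x : 0 <= ppart x. Proof. by case/andP: (ljoin_ge x 0). Qed.

Lemma ppart_le x y : x <= y -> 0 <= y -> ppart x <= y.
Proof. by move=> xy y0; rewrite /ppart ljoin_le xy. Qed.

(** In a representation of [G] by functions: [g <= 0] wherever [p > 0]. *)
Definition neg_on p g : Prop := forall w, w <= ppart g -> w <= p -> w <= 0.

Lemma neg_on_le p g h : g <= h -> neg_on p h -> neg_on p g.
Proof.
move=> gh nh w wg wp; apply: nh => //; apply: le_trans wg _.
by apply: ppart_le; [exact: le_trans gh (ppart_ge h) | exact: ppart_ge0].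
Qed.

Lemma neg_on_sub p q g : q <= p -> neg_on p g -> neg_on q g.
Proof. by move=> qp ng w wg wq; apply: ng => //; exact: le_trans qp. Qed.

Lemma neg_on_le0 p g : g <= 0 -> neg_on p g.
Proof. by move=> g0 w wg _; apply: le_trans wg _; exact: ppart_le. Qed.

(** Subtracting [ppart g] from a common lower bound [w] leaves an element below [ppart h] and [p],
    hence [w <= ppart g]. The subtraction is legitimate because [neg_on] quantifies over all [w],
    not only positive ones. *)
Lemma neg_onD p g h : neg_on p g -> neg_on p h -> neg_on p (g + h).
Proof.
move=> ng nh w wgh wp.
have wgh' : w <= ppart g + ppart h.
  apply: le_trans wgh _; apply: ppart_le; first by rewrite lg_leD ?ppart_ge.
  by rewrite lg_addr_ge0 ?ppart_ge0.
apply: ng => //; rewrite -(add0r (ppart g)) -lg_leBlD; apply: nh.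
  by rewrite lg_leBlD addrC.
by rewrite lg_leBlD -(addr0 w) lg_leD ?ppart_ge0.
Qed.

Lemma neg_onMn p g n : neg_on p g -> neg_on p (g *+ n).
Proof.
move=> ng; elim: n => [|n IH]; first by rewrite mulr0n; exact: neg_on_le0.
by rewrite mulrS; exact: neg_onD.
Qed.

(** Positive and negative parts are disjoint: if [w] is below [ppart g] and [ppart (- g)], then
    [ppart (- g) - w] is above both [- g] and 0. *)
Lemma neg_on_opp p g : p <= ppart g -> neg_on p (- g).
Proof.
move=> pg w wN wp.
have wg := le_trans wp pg.
have E : ppart g <= g + ppart (- g).
  rewrite ppart_le//; first by rewrite -{1}(addr0 g) lg_leD2l ppart_ge0.
  by rewrite -(subrr g) lg_leD2l ppart_ge.
have : ppart (- g) <= ppart (- g) - w.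
  apply: ppart_le; last by rewrite lg_subr_ge0.
  by rewrite lg_leBrD addrC lg_leBlD addrC; exact: le_trans wg E.
by rewrite lg_leBrD -{2}(addr0 (ppart (- g))) lg_leD2l.
Qed.

Lemma lg_posP x : 0 <= x -> ~ x <= 0 -> 0 < x.
Proof. by move=> x0 nx; rewrite lt_neqAle x0 andbT; apply/eqP => E; apply: nx; rewrite -E. Qed.

Lemma lg_npos x : 0 < x -> ~ x <= 0.
Proof. by move=> /lt_le_trans h /h; rewrite ltxx. Qed.

(** Every [p] can be shrunk so as to decide the sign of [g]. The witness is the meet of [ppart g]
    and [p], which vanishes exactly in the first case. *)
Lemma neg_on_dich p g : 0 < p ->
  neg_on p g \/ exists q, [/\ 0 < q, q <= p & neg_on q (- g)].
Proof.
move=> p0; have [ng|ng] := pselect (neg_on p g); [by left | right].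
have /andP[m1 m2] := lmeet_le (ppart g) p.
exists (lmeet (ppart g) p); split => //; last exact: neg_on_opp.
apply: lg_posP; first by rewrite le_lmeet ppart_ge0 ltW.
by move=> m0; apply: ng => w wg wp; apply: le_trans m0; rewrite le_lmeet wg.
Qed.

(** If [w] is the supremum of the multiples of [d], then [w - d] bounds them as well. *)
Lemma archimedean_lgroup (hG : dedekind_sigma_complete G) (u d : G) :
  (forall m : nat, d *+ m <= u) -> d <= 0.
Proof.
move=> du; have [] := hG (range (fun m : nat => d *+ m)).
- exact: card_image_le.
- by exists (d *+ 0); exists 0%N.
- by exists u => _ [m _ <-].
- move=> w [wub wlub]; suff : w <= w - d by rewrite lg_leBrD -{2}(addr0 w) lg_leD2l.
  apply: wlub => _ [m _ <-]; rewrite lg_leBrD -mulrSr; apply: wub.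
  by exists m.+1.
Qed.

End LGroupTheory.

(** * Real functionals defined by generic chains *)

Section GenericSequences.
Variables (R : realType) (G : lgroupType) (u : G).
Implicit Types (p : nat -> G) (g h : G) (D : set G).

(** In forcing terms the conditions are the elements [p] with [0 < p <= u], smaller ones being
    stronger; a chain that meets the prescribed dense sets plays the role of the generic filter. *)
Definition dense_below D := forall p : G, 0 < p -> p <= u ->
  exists q, [/\ 0 < q, q <= p & D q].

Definition chain p := (forall i, 0 < p i /\ p i <= u) /\ forall i, p i.+1 <= p i.

(** [aeg P]: the property [P] holds for all sufficiently generic chains. *)
Definition aeg (P : (nat -> G) -> Prop) : Prop :=
  exists D : nat -> set G, (forall k, dense_below (D k)) /\
    forall p, chain p -> (forall k, exists i, D k (p i)) -> P p.

Lemma chain_le p i j : chain p -> (i <= j)%N -> p j <= p i.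
Proof.
move=> [_ dp] ij; rewrite -(subnKC ij); elim: (j - i)%N => [|k IH].
  by rewrite addn0.
by rewrite addnS; apply: le_trans IH.
Qed.

Lemma aeg_imp (P Q : (nat -> G) -> Prop) :
  (forall p, chain p -> P p -> Q p) -> aeg P -> aeg Q.
Proof. by move=> h [D [dD hD]]; exists D; split => // p cp mp; apply: h => //; exact: hD. Qed.

(** The countably many sequences of dense sets are merged into one through [pickle]; a number that
    codes no pair receives [setT]. *)
Lemma aeg_all (I : countType) (P : I -> (nat -> G) -> Prop) :
  (forall k, aeg (P k)) -> aeg (fun p => forall k, P k p).
Proof.
move=> h; have [D hD] := choice h.
exists (fun m => if unpickle m is Some (k, j) then D k j else setT); split.
  move=> m; case: unpickle => [[k j]|]; first by have [hd _] := hD k; exact: hd.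
  by move=> p p0 _; exists p.
move=> p cp hp k; have [_] := hD k; apply => // j.
by have := hp (pickle (k, j)); rewrite pickleK.
Qed.

Lemma aeg_and P Q : aeg P -> aeg Q -> aeg (fun p => P p /\ Q p).
Proof.
move=> hP hQ; have : aeg (fun p => forall b : bool, if b then P p else Q p).
  by apply: aeg_all => -[].
by apply: aeg_imp => p _ h; split; [exact: (h true) | exact: (h false)].
Qed.

(** The Rasiowa-Sikorski construction: [D k] is met at index [k.+1], which leaves the start of the
    chain free. Separation of points depends on that freedom. *)
Lemma aeg_exists P (q : G) : aeg P -> 0 < q -> q <= u ->
  exists p, [/\ chain p, P p & p 0%N = q].
Proof.
move=> [D [dD hD]] q0 qu.
have /choice[st hst] : forall kp : nat * G, exists q, 0 < kp.2 -> kp.2 <= u ->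
    [/\ 0 < q, q <= kp.2 & D kp.1 q].
  move=> [k p]; have [p0|] := boolP (0 < p); last by exists 0.
  have [pu|] := boolP (p <= u); last by exists 0.
  by have [r hr] := dD k _ p0 pu; exists r.
pose p := fix p k := if k is k'.+1 then st (k', p k') else q.
have hp k : 0 < p k /\ p k <= u.
  elim: k => [//|k [IH1 IH2]] /=.
  by have [h1 h2 _] := hst (k, p k) IH1 IH2; split => //; exact: le_trans IH2.
have cp : chain p.
  by split=> // k; have [h1 h2] := hp k; have [] := hst (k, p k) h1 h2.
exists p; split => //; apply: hD => // k; exists k.+1.
by have [h1 h2] := hp k; have [] := hst (k, p k) h1 h2.
Qed.

(** The order ideal generated by [u], on which [phi] is finite. *)
Definition ub g := exists m : nat, g <= u *+ m /\ - g <= u *+ m.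

(** The upper half of a Dedekind cut: [a / b.+1] bounds [g / u] from above on some member of the
    chain. *)
Definition cut p g (a : int) (b : nat) :=
  exists i, neg_on (p i) (g *+ b.+1 - u *~ a).

(** The value of [g / u] at the point to which the chain shrinks. *)
Definition phi p g : R :=
  inf [set x | exists a b, cut p g a b /\ x = a%:~R / b.+1%:R].

Hypothesis u0 : 0 <= u.

Lemma ubN g : ub g -> ub (- g).
Proof. by move=> [m [h1 h2]]; exists m; rewrite opprK. Qed.

Lemma ubD g h : ub g -> ub h -> ub (g + h).
Proof.
move=> [m [g1 g2]] [k [h1 h2]]; exists (m + k)%N.
by rewrite opprD mulrnDr !lg_leD.
Qed.

Lemma ubB g h : ub g -> ub h -> ub (g - h).
Proof. by move=> ? ?; apply: ubD => //; exact: ubN. Qed.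

Lemma ub01 g : 0 <= g -> g <= u -> ub g.
Proof.
move=> g0 gu; exists 1%N; rewrite mulr1n; split => //.
by apply: le_trans u0; rewrite lg_oppr_le0.
Qed.

Lemma cut_ge p g a b m : chain p -> cut p g a b -> - g <= u *+ m ->
  - m%:R <= a%:~R / b.+1%:R :> R.
Proof.
move=> cp [i ng] gm; rewrite ler_pdivlMr ?ltr0Sn// leNgt; apply/negP => ab.
(* By integrality the gap is at least 1, that is, one copy of [u], which dominates [p i]. *)
have {ab} ab : 1 <= - a - (m * b.+1)%:Z.
  have: a < - (m * b.+1)%:Z.
    by rewrite -(ltr_int R) rmorphN /= -pmulrn natrM -mulNr.
  by lia.
have [pi0 piu] := cp.1 i.
apply: (lg_npos pi0); apply: ng => //; apply: le_trans piu _.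
apply: le_trans (ppart_ge _).
apply: (@le_trans _ _ (u *~ (- a - (m * b.+1)%:Z))).
  by rewrite -{1}(mulr1z u) lg_leMz.
rewrite mulrzBr mulrNz addrC lg_leD2r -pmulrn mulrnA.
by rewrite -lg_leN2 opprK -mulNrn lg_leMn.
Qed.

Lemma cut_up p g m : g <= u *+ m -> cut p g m%:Z 0.
Proof. by move=> gm; exists 0%N; apply: neg_on_le0; rewrite lg_leBlD add0r mulr1n -pmulrn. Qed.

Lemma phi_le p g a b : chain p -> ub g -> cut p g a b -> phi p g <= a%:~R / b.+1%:R.
Proof.
move=> cp [m [_ gm]] c; apply: ge_inf; last by exists a, b.
by exists (- m%:R) => _ [a' [b' [c' ->]]]; exact: (cut_ge cp c' gm).
Qed.

Lemma phi_lt p g r : chain p -> ub g -> phi p g < r ->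
  exists a b, cut p g a b /\ a%:~R / b.+1%:R < r.
Proof.
move=> cp [m [gm _]] /inf_lt[|x [a [b [c ->]]] xr]; last by exists a, b.
by exists (m%:Z%:~R / 1%:R), m%:Z, 0%N; split => //; exact: cut_up.
Qed.

Lemma phi_ge p g r : chain p -> ub g ->
  (forall a b, cut p g a b -> r <= a%:~R / b.+1%:R) -> r <= phi p g.
Proof.
move=> cp ug h; rewrite leNgt; apply/negP => /(phi_lt cp ug)[a [b [c]]].
by rewrite ltNge h.
Qed.

Lemma phi_mono p g h : chain p -> ub g -> ub h -> g <= h -> phi p g <= phi p h.
Proof.
move=> cp ug uh gh; apply: phi_ge => // a b [i c]; apply: phi_le => //.
by exists i; apply: neg_on_le c; rewrite lg_leD2r lg_leMn.
Qed.

Lemma phi0 p : chain p -> phi p 0 = 0.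
Proof.
move=> cp; have ub0 : ub 0 by exact: ub01.
apply/eqP; rewrite eq_le; apply/andP; split.
  have /(phi_le cp ub0) : cut p 0 0 0 by exact: (@cut_up p 0 0).
  by rewrite mul0r.
apply: phi_ge => // a b c; have := @cut_ge p 0 a b 0 cp c.
by rewrite !oppr0 !mulr0n; apply.
Qed.

Lemma phi_ge0 p g : chain p -> ub g -> 0 <= g -> 0 <= phi p g.
Proof. by move=> cp ug g0; rewrite -(phi0 cp) phi_mono//; exact: ub01. Qed.

Lemma phiD_le p g h : chain p -> ub g -> ub h ->
  phi p (g + h) <= phi p g + phi p h.
Proof.
move=> cp ug uh; apply/ler_addgt0Pr => e e0.
have e2 : 0 < e / 2 by rewrite divr_gt0.
have [a [b [[i c] ab]]] : exists a b, cut p g a b /\ a%:~R / b.+1%:R < phi p g + e / 2.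
  by apply: phi_lt => //; rewrite ltrDl.
have [a' [b' [[j c'] ab']]] : exists a b, cut p h a b /\ a%:~R / b.+1%:R < phi p h + e / 2.
  by apply: phi_lt => //; rewrite ltrDl.
(* Common denominator [b.+1 * b'.+1], stored minus one. *)
have cgh : cut p (g + h) (a * b'.+1%:Z + a' * b.+1%:Z) (b * b' + b + b')%N.
  exists (maxn i j).
  have E : (b * b' + b + b').+1 = (b.+1 * b'.+1)%N by lia.
  have -> : (g + h) *+ (b * b' + b + b').+1 - u *~ (a * b'.+1%:Z + a' * b.+1%:Z)
     = (g *+ b.+1 - u *~ a) *+ b'.+1 + (h *+ b'.+1 - u *~ a') *+ b.+1.
    rewrite E mulrnDl !mulrnBl mulrzDr opprD !mulrzA -!pmulrn.
    by rewrite -!mulrnA (mulnC b'.+1) addrACA.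
  apply: neg_onD; apply: neg_onMn.
    by apply: neg_on_sub c; apply: chain_le => //; exact: leq_maxl.
  by apply: neg_on_sub c'; apply: chain_le => //; exact: leq_maxr.
apply: le_trans (phi_le cp (ubD ug uh) cgh) _.
have -> : (a * b'.+1%:Z + a' * b.+1%:Z)%:~R / (b * b' + b + b').+1%:R
   = a%:~R / b.+1%:R + a'%:~R / b'.+1%:R :> R.
  have E : (b * b' + b + b').+1 = (b.+1 * b'.+1)%N by lia.
  by rewrite E natrM intrD !intrM addf_div ?pnatr_eq0.
by apply: le_trans (ltW (ltrD ab ab')) _; rewrite addrACA -splitr.
Qed.

(** Subadditivity gives one inequality for every chain. For the other, the chain is made to decide
    on which side of each rational multiple of [u] the element [g] lies; a rational strictly between
    the two values would contradict either decision. *)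
Lemma aeg_phiN g : ub g -> aeg (fun p => phi p (- g) = - phi p g).
Proof.
move=> ug; have ugN := ubN ug.
have : aeg (fun p => forall ab : int * nat, cut p g ab.1 ab.2 \/ cut p (- g) (- ab.1) ab.2).
  apply: aeg_all => -[a b] /=.
  exists (fun=> [set q | neg_on q (g *+ b.+1 - u *~ a) \/
                         neg_on q ((- g) *+ b.+1 - u *~ (- a))]); split.
    move=> _ q q0 qu; have [ng|[r [r0 rq nr]]] := neg_on_dich (g *+ b.+1 - u *~ a) q0.
      by exists q; split => //; left.
    by exists r; split => //; right; move: nr; rewrite opprB mulNrn mulrNz opprK addrC.
  by move=> p cp /(_ 0%N)[i [c|c]]; [left|right]; exists i.
apply: aeg_imp => p cp h; apply/eqP; rewrite eq_le; apply/andP; split; last first.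
  by have := phiD_le cp ug ugN; rewrite subrr phi0//; lra.
rewrite leNgt; apply/negP => /rat_in_itvoo[q]; rewrite in_itv /= => /andP[q1 q2].
have [b bq] : exists b : nat, denq q = b.+1%:Z.
  by have := denq_gt0 q; case: (denq q) => // -[//|b] _; exists b.
have qE : ratr q = (numq q)%:~R / b.+1%:R :> R by rewrite /ratr bq.
have [c|c] := h (- numq q, b).
  have := phi_le cp ug c; rewrite /= rmorphN /= mulNr -qE.
  by move=> ?; lra.
have := phi_le cp ugN c; rewrite /= opprK -qE.
by move=> ?; lra.
Qed.

Lemma aeg_phiB g h : ub g -> ub h -> aeg (fun p => phi p (g - h) = phi p g - phi p h).
Proof.
move=> ug uh; have := aeg_and (aeg_phiN uh) (aeg_phiN (ubB ug uh)).
apply: aeg_imp => p cp [e1 e2]; apply/eqP; rewrite eq_le; apply/andP; split.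
  by rewrite -e1; apply: phiD_le => //; exact: ubN.
have := phiD_le cp (ubN (ubB ug uh)) ug.
rewrite opprB subrK => k; have := phiD_le cp (ubB ug uh) uh.
by rewrite subrK; lra.
Qed.

(** Monotonicity decouples the indices: [w] lies below [y j + y k *+ m] for independent [j] and [k],
    both terms being larger than at [maxn j k]. *)
Lemma inf_mulrn (y : nat -> G) m : (forall j k, (j <= k)%N -> y k <= y j) ->
  (forall w, (forall j, w <= y j) -> w <= 0) ->
  forall w, (forall j, w <= y j *+ m) -> w <= 0.
Proof.
move=> dy iy; elim: m => [|m IH] w hw; first by have := hw 0%N.
apply: IH => k; rewrite -(add0r (y k *+ m)) -lg_leBlD; apply: iy => j.
rewrite lg_leBlD; apply: le_trans (hw (maxn j k)) _.
rewrite mulrS lg_leD ?lg_leMn// dy ?leq_maxl ?leq_maxr//.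
Qed.

(** For each [m], the conditions that force some [s - a j] below [u / m.+1] are dense. If none were
    found below [q], then, since [q <= u], the element [q] itself would lie below every
    [(s - a j) *+ m.+1], whose infimum is 0. *)
Lemma aeg_phi_sup (a : nat -> G) s : (forall j, ub (a j)) -> ub s ->
  (forall j k, (j <= k)%N -> a j <= a k) ->
  (forall j, a j <= s) -> (forall w, (forall j, a j <= w) -> s <= w) ->
  aeg (fun p => (fun j => phi p (a j)) @ \oo --> phi p s).
Proof.
move=> ua us ma as_ la.
have : aeg (fun p => (forall m : nat, exists j, cut p (s - a j) 1 m) /\
    forall j, phi p (s - a j) = phi p s - phi p (a j)).
  apply: aeg_and; last by apply: aeg_all => j; exact: aeg_phiB.
  apply: aeg_all => m.
  exists (fun=> [set q | exists j, neg_on q ((s - a j) *+ m.+1 - u *~ 1)]); split; last first.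
    by move=> p cp /(_ 0%N)[i [j c]]; exists j, i.
  move=> _ q q0 qu; apply: contrapT => hn.
  apply: (lg_npos q0); apply: (@inf_mulrn (fun j => s - a j) m.+1) => [j k jk|w hw|j].
  - by rewrite lg_leD2l lg_leN2 ma.
  - suff : s <= s - w by rewrite lg_leBrD -{2}(addr0 s) lg_leD2l.
    by apply: la => j; rewrite lg_leBrD addrC -lg_leBrD.
  - have ng : neg_on q (- ((s - a j) *+ m.+1 - u *~ 1)).
      have [//|[r [r0 rq nr]]] := neg_on_dich (- ((s - a j) *+ m.+1 - u *~ 1)) q0.
      exfalso; apply: hn; exists r; split => //; exists j.
      by move: nr; rewrite opprK.
    rewrite -lg_subr_ge0 -lg_oppr_le0 opprB; apply: ng.
      by apply: le_trans (ppart_ge _); rewrite opprB mulr1z lg_leD2r.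
    rewrite lg_leBlD -{1}(addr0 q) lg_leD2l lg_mulrn_ge0// lg_subr_ge0//.
apply: aeg_imp => p cp [h1 h2]; apply/cvgrPdist_le => /= e e0.
have [m me] : exists m : nat, m.+1%:R^-1 < e.
  by have [m _ hm] := near_infty_natSinv_lt (PosNum e0); exists m; apply: hm => /=.
have [j cj] := h1 m; exists j => // k /= jk.
rewrite -h2 ger0_norm; last first.
  by apply: phi_ge0 => //; [exact: ubB | rewrite lg_subr_ge0].
apply: le_trans (ltW me); rewrite -(mul1r m.+1%:R^-1).
apply: le_trans (phi_le cp (ubB us (ua j)) cj).
by apply: phi_mono; rewrite ?lg_leD2l ?lg_leN2 ?ma//; exact: ubB.
Qed.

Lemma disj_mulrn (x p : G) k : 0 <= x -> (forall w, w <= x -> w <= p -> w <= 0) ->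
  forall w, w <= x *+ k -> w <= p -> w <= 0.
Proof.
move=> x0 h w wx wp.
have E : ppart x = x.
  by apply/eqP; rewrite eq_le ppart_ge andbT ppart_le.
have : neg_on p (x *+ k) by apply: neg_onMn; rewrite /neg_on E.
by apply => //; exact: le_trans (ppart_ge _).
Qed.

(** If [d = g - h] is not [<= 0], some multiple [d *+ m.+1] is not below [u]. A generic chain
    started inside the positive part of [d *+ m.+1 - u] then gives [d] a value of at least
    [1 / m.+1]. *)
Lemma aeg_phi_le (hG : dedekind_sigma_complete G) g h : ub g -> ub h ->
  aeg (fun p => phi p g <= phi p h) -> g <= h.
Proof.
move=> ug uh H; set d := g - h; have ud : ub d by exact: ubB.
suff : d <= 0 by rewrite lg_leBlD add0r.
apply: contrapT => nd.
have [m dm] : exists m : nat, ~ d *+ m <= u.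
  by apply: contrapT => hn; apply: nd; apply: (archimedean_lgroup hG (u := u)) => m;
    apply: contrapT => ?; apply: hn; exists m.
have [k [dk _]] := ud.
case: m dm => [|m] dm; first by rewrite mulr0n in dm.
set e := d *+ m.+1 - u in dm *.
have e_le : ppart e <= u *+ (k * m.+1).
  apply: ppart_le; last exact: lg_mulrn_ge0.
  rewrite lg_leBlD mulrnA -(addr0 (d *+ _)) lg_leD//.
  exact: lg_leMn.
have /andP[q1 q2] := lmeet_le (ppart e) u.
set q := lmeet (ppart e) u in q1 q2 *.
(* Otherwise [u] would be disjoint from [ppart e]; as [ppart e] lies below a multiple of [u], it
   would vanish, against the choice of [m]. *)
have q0 : 0 < q.
  apply: lg_posP; first by rewrite le_lmeet ppart_ge0 u0.
  move=> qn; apply: dm; rewrite -lg_subr_ge0 -lg_oppr_le0 opprB -/e.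
  apply: le_trans (ppart_ge e) _.
  apply: (@disj_mulrn u (ppart e) (k * m.+1)) => // w w1 w2.
  by apply: le_trans qn; rewrite le_lmeet w1 w2.
have [p [cp [[hp e1] e2] p0q]] :=
  aeg_exists (aeg_and (aeg_and H (aeg_phiB ug uh)) (aeg_phiN ud)) q0 q2.
have /(phi_le cp (ubN ud)) : cut p (- d) (-1) m.
  exists 0%N; rewrite p0q; have := neg_on_opp q1.
  by rewrite /e opprB mulrNz mulr1z opprK mulNrn addrC.
rewrite e2 e1 rmorphN /= mulNr mul1r.
have : 0 < m.+1%:R^-1 :> R by rewrite invr_gt0.
rewrite lerN2 => h1 h2; have := lt_le_trans h1 h2.
by rewrite subr_gt0 ltNge hp.
Qed.

End GenericSequences.

(** * Volumes of boxes *)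

Section Volume.
Variables (K : Type) (n : nat).
Implicit Types (a b s t : 'rV[K]_n) (i j : 'I_n) (l : seq 'I_n).

Definition setc t i (r : K) : 'rV[K]_n := \row_j (if j == i then r else t 0 j).

Lemma setcE t i r j : setc t i r 0 j = if j == i then r else t 0 j.
Proof. by rewrite mxE. Qed.

Lemma setc_id t i : setc t i (t 0 i) = t.
Proof. by apply/rowP => j; rewrite setcE; case: eqP => // ->. Qed.

Lemma setcC t i j x y : i != j -> setc (setc t i x) j y = setc (setc t j y) i x.
Proof.
move=> ij; apply/rowP => k; rewrite !setcE.
by case: (eqVneq k j) => [->|//]; rewrite eq_sym; case: eqVneq ij.
Qed.

Lemma setcc t i x y : setc (setc t i x) i y = setc t i y.
Proof. by apply/rowP => k; rewrite !setcE; case: (k == i). Qed.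

(** The volume of the statement with the list of differenced coordinates as a parameter, so that
    partial increments are available to inductions; coordinates outside [l] are read off [t]. *)
Definition vol (V : zmodType) (f : 'rV[K]_n -> V) a b l : 'rV[K]_n -> V :=
  foldr (fun i g t => g (setc t i (b 0 i)) - g (setc t i (a 0 i))) f l.

Arguments vol : simpl never.

Section VolumeTheory.
Variable V : zmodType.
Implicit Types f g : 'rV[K]_n -> V.

Lemma vol_cons f a b i l t : vol f a b (i :: l) t =
  vol f a b l (setc t i (b 0 i)) - vol f a b l (setc t i (a 0 i)).
Proof. by []. Qed.

Lemma vol_indep f a b l t t' : (forall i, i \notin l -> t 0 i = t' 0 i) ->
  vol f a b l t = vol f a b l t'.
Proof.
elim: l t t' => [|i l IH] t t' tt'.
  by congr f; apply/rowP => i; exact: tt'.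
rewrite !vol_cons; congr (_ - _); apply: IH => j jl; rewrite !setcE;
  by case: eqP => // /eqP ji; apply: tt'; rewrite inE negb_or ji.
Qed.

Lemma eq_vol f a b a' b' l t : (forall i, i \in l -> a 0 i = a' 0 i) ->
  (forall i, i \in l -> b 0 i = b' 0 i) -> vol f a b l t = vol f a' b' l t.
Proof.
elim: l t => [//|i l IH] t aa bb.
rewrite !vol_cons aa ?bb ?mem_head// !IH// => j jl; rewrite ?aa ?bb// inE jl orbT//.
Qed.

Lemma vol_pull f a b i l t : i \in l -> vol f a b l t =
  vol f a b (rem i l) (setc t i (b 0 i)) - vol f a b (rem i l) (setc t i (a 0 i)).
Proof.
elim: l t => [//|j l IH] t; rewrite inE [rem _ _]/=.
have [->|ji] := eqVneq j i; first by [].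
move=> /= il; rewrite !vol_cons !IH//.
rewrite !(setcC _ _ _ ji) !opprB addrACA [RHS]addrACA; congr (_ + _).
exact: addrC.
Qed.

Lemma vol_split f a b i x l t : uniq l -> i \in l ->
  vol f a b l t = vol f a (setc b i x) l t + vol f (setc a i x) b l t.
Proof.
move=> ul il; rewrite !(vol_pull _ _ _ _ il) !setcE eqxx.
have E1 t' : vol f a (setc b i x) (rem i l) t' = vol f a b (rem i l) t'.
  by apply: eq_vol => // j; rewrite mem_rem_uniq// inE setcE => /andP[/negbTE->].
have E2 t' : vol f (setc a i x) b (rem i l) t' = vol f a b (rem i l) t'.
  by apply: eq_vol => // j; rewrite mem_rem_uniq// inE setcE => /andP[/negbTE->].
by rewrite !E1 !E2 [RHS]addrC addrA subrK.
Qed.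

Lemma vol_degenerate f a b i l t : i \in l -> a 0 i = b 0 i -> vol f a b l t = 0.
Proof. by move=> il ab; rewrite (vol_pull _ _ _ _ il) ab subrr. Qed.

Lemma volD f g a b l t :
  vol (fun s => f s + g s) a b l t = vol f a b l t + vol g a b l t.
Proof. by elim: l t => [//|i l IH] t; rewrite !vol_cons !IH opprD addrACA. Qed.

End VolumeTheory.

(** Additivity of [h] is asked only for the differences that occur, since a generic [phi p] is known
    to be additive only on countably many prescribed elements. *)
Lemma vol_map (V W : zmodType) (h : V -> W) (f : 'rV[K]_n -> V) a b l t :
  (forall l t t', h (vol f a b l t - vol f a b l t') =
                  h (vol f a b l t) - h (vol f a b l t')) ->
  h (vol f a b l t) = vol (h \o f) a b l t.
Proof. by move=> hh; elim: l t => [//|i l IH] t; rewrite !vol_cons hh !IH. Qed.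


End Volume.

Arguments vol : simpl never.

Definition vmax (K : realDomainType) n (a b : 'rV[K]_n) : 'rV[K]_n :=
  \row_i Num.max (a 0 i) (b 0 i).
Definition vmin (K : realDomainType) n (a b : 'rV[K]_n) : 'rV[K]_n :=
  \row_i Num.min (a 0 i) (b 0 i).

(** * Finite subadditivity for half-open rational boxes *)

Section RationalBoxes.
Variables (R : realType) (n : nat) (f : 'rV[rat]_n -> R).
Implicit Types (a b c d s t : 'rV[rat]_n) (i j : 'I_n).

(** Replacing [b] by [vmax a b] gives empty boxes volume 0 and removes the side condition on the
    corners. *)
Definition bvol a b : R := vol f a (vmax a b) (enum 'I_n) a.

Lemma volT a b t t' : vol f a b (enum 'I_n) t = vol f a b (enum 'I_n) t'.
Proof. by apply: vol_indep => i; rewrite mem_enum. Qed.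

Lemma bvol0 a b i : b 0 i <= a 0 i -> bvol a b = 0.
Proof.
move=> ba; apply: (@vol_degenerate _ _ _ _ _ _ i); first by rewrite mem_enum.
by rewrite mxE max_l.
Qed.

Lemma bvol_clip a b i x : bvol a b =
  bvol a (setc b i (Num.min (b 0 i) x)) + bvol (setc a i (Num.max (a 0 i) x)) b.
Proof.
have [/existsP[j jab]|] := boolP [exists j, b 0 j <= a 0 j].
  rewrite !(@bvol0 _ _ j) ?addr0// setcE.
    by case: eqP => // <-; apply: le_trans jab _; rewrite le_max lexx.
  by case: eqP => // <-; rewrite ge_min jab.
rewrite negb_exists => /forallP ab; have {}ab j : a 0 j < b 0 j by rewrite ltNge.
have [xa|ax] := leP x (a 0 i).
  rewrite [X in X + _](@bvol0 _ _ i) ?setcE ?eqxx ?ge_min ?xa ?orbT//.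
  by rewrite setc_id add0r.
have [bx|xb] := leP (b 0 i) x.
  rewrite [X in _ + X](@bvol0 _ _ i) ?setcE ?eqxx ?le_max ?bx ?orbT//.
  by rewrite setc_id addr0.
rewrite /bvol (@vol_split _ _ _ _ _ _ i x) ?enum_uniq ?mem_enum//; congr (_ + _).
  apply: eq_vol => // j _; rewrite !mxE; case: eqP => // ->.
  by rewrite max_r// ltW.
rewrite (volT _ _ _ (setc a i x)); apply: eq_vol => // j _; rewrite !mxE.
by case: eqP => // ->; rewrite !max_r ?ltW.
Qed.

Hypothesis bvol_ge0 : forall a b, 0 <= bvol a b.

(** Clipping is done one coordinate at a time, and each clip discards a piece of nonnegative
    volume. *)
Lemma bvol_clip_le a b c d : bvol (vmax a c) (vmin b d) <= bvol a b.
Proof.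
pose amax (l : seq 'I_n) : 'rV[rat]_n :=
  \row_j if j \in l then Num.max (a 0 j) (c 0 j) else a 0 j.
pose bmin (l : seq 'I_n) : 'rV[rat]_n :=
  \row_j if j \in l then Num.min (b 0 j) (d 0 j) else b 0 j.
have Ha l b' : bvol (amax l) b' <= bvol a b'.
  elim: l => [|i l IH].
    by rewrite (_ : amax [::] = a)//; apply/rowP => j; rewrite mxE.
  apply: le_trans IH; rewrite [leRHS](bvol_clip _ _ i (c 0 i)).
  rewrite (_ : amax (i :: l) = setc (amax l) i (Num.max (amax l 0 i) (c 0 i))).
    by rewrite lerDr.
  apply/rowP => j; rewrite !mxE inE; have [->|//] := eqVneq j i.
  by case: (i \in l) => //; rewrite -maxA maxxx.
have Hb l a' : bvol a' (bmin l) <= bvol a' b.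
  elim: l => [|i l IH].
    by rewrite (_ : bmin [::] = b)//; apply/rowP => j; rewrite mxE.
  apply: le_trans IH; rewrite [leRHS](bvol_clip _ _ i (d 0 i)).
  rewrite (_ : bmin (i :: l) = setc (bmin l) i (Num.min (bmin l 0 i) (d 0 i))).
    by rewrite lerDl.
  apply/rowP => j; rewrite !mxE inE; have [->|//] := eqVneq j i.
  by case: (i \in l) => //; rewrite -minA minxx.
apply: le_trans (Ha (enum 'I_n) b); apply: le_trans (Hb (enum 'I_n) _).
rewrite le_eqVlt; apply/orP; left; apply/eqP; congr bvol; apply/rowP => j;
  by rewrite !mxE mem_enum.
Qed.

Definition inbox a b s := [forall i, a 0 i <= s 0 i < b 0 i].

(** Cutting along one hyperplane at a time until no face of a covering box
    meets the interior of [[a, b)]; then one covering box contains it. *)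
Lemma bvol_finite_subadditive_cut (Cs : seq ('rV[rat]_n * 'rV[rat]_n))
    (H : seq ('I_n * rat)) a b :
  (forall C i x, C \in Cs -> x = C.1 0 i \/ x = C.2 0 i ->
    a 0 i < x < b 0 i -> (i, x) \in H) ->
  (forall s, inbox a b s -> exists2 C, C \in Cs & inbox C.1 C.2 s) ->
  bvol a b <= \sum_(C <- Cs) bvol (vmax a C.1) (vmin b C.2).
Proof.
elim: H a b => [|[i x] H IH] a b hH cov.
  have [/existsP[j jab]|] := boolP [exists j, b 0 j <= a 0 j].
    by rewrite (bvol0 jab) sumr_ge0.
  rewrite negb_exists => /forallP ab; have {}ab j : a 0 j < b 0 j by rewrite ltNge.
  (* The covering box that contains the corner [a] contains the whole box: otherwise one of its
     upper faces would meet the interior. *)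
  have [|C CC /forallP aC] := cov a; first by apply/forallP => i; rewrite lexx ab.
  rewrite (big_rem C CC) /= -[leLHS]addr0 lerD ?sumr_ge0//.
  rewrite le_eqVlt; apply/orP; left; apply/eqP; congr bvol; apply/rowP => i; rewrite mxE.
    by rewrite max_l//; have /andP[] := aC i.
  rewrite min_l// leNgt; apply/negP => Cb; have /andP[_ aCi] := aC i.
  by have := hH C i (C.2 0 i) CC (or_intror erefl); rewrite aCi Cb => /(_ isT).
rewrite (bvol_clip _ _ i x).
have cut C : bvol (vmax a C.1) (vmin b C.2) =
    bvol (vmax a C.1) (vmin (setc b i (Num.min (b 0 i) x)) C.2) +
    bvol (vmax (setc a i (Num.max (a 0 i) x)) C.1) (vmin b C.2).
  rewrite (bvol_clip _ _ i x); congr (bvol _ _ + bvol _ _); apply/rowP => j;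
    rewrite !mxE; case: eqP => // ->; first by rewrite minAC.
  by rewrite maxAC.
under eq_bigr do rewrite cut.
rewrite big_split /= lerD//; apply: IH.
- move=> C j y CC hy; rewrite setcE; case: eqP => [E|/eqP ji] /andP[ay yb].
    subst j; have h := hH C i y CC hy; rewrite inE in h.
    move: yb; rewrite lt_min => /andP[yb yx]; move: h.
    by rewrite ay yb xpair_eqE eqxx /= (lt_eqF yx); apply.
  by have := hH C j y CC hy; rewrite ay yb inE xpair_eqE (negbTE ji) => /(_ isT).
- move=> s /forallP hs; apply: cov; apply/forallP => j; have := hs j; rewrite setcE.
  by case: eqP => // ->; rewrite lt_min => /and3P[-> ->].
- move=> C j y CC hy; rewrite setcE; case: eqP => [E|/eqP ji] /andP[ay yb].
    subst j; have h := hH C i y CC hy; rewrite inE in h.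
    move: ay; rewrite gt_max => /andP[ay xy]; move: h.
    by rewrite ay yb xpair_eqE eqxx /= (gt_eqF xy); apply.
  by have := hH C j y CC hy; rewrite ay yb inE xpair_eqE (negbTE ji) => /(_ isT).
- move=> s /forallP hs; apply: cov; apply/forallP => j; have := hs j; rewrite setcE.
  by case: eqP => // ->; rewrite ge_max => /andP[/andP[-> _] ->].
Qed.

Lemma bvol_finite_subadditive (Cs : seq ('rV[rat]_n * 'rV[rat]_n)) a b :
  (forall s, inbox a b s -> exists2 C, C \in Cs & inbox C.1 C.2 s) ->
  bvol a b <= \sum_(C <- Cs) bvol C.1 C.2.
Proof.
move=> cov; pose faces (C : 'rV[rat]_n * 'rV[rat]_n) :=
  [seq (i, C.1 0 i) | i <- enum 'I_n] ++ [seq (i, C.2 0 i) | i <- enum 'I_n].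
apply: le_trans (@bvol_finite_subadditive_cut Cs (flatten (map faces Cs)) a b _ cov) _.
  move=> C i x CC hx _; apply/flattenP; exists (faces C); first exact: map_f.
  rewrite mem_cat; apply/orP; case: hx => ->; [left|right];
    by apply/mapP; exists i; rewrite ?mem_enum.
apply: ler_sum => C _.
suff -> : vmax a C.1 = vmax C.1 a by
  rewrite (_ : vmin b C.2 = vmin C.2 b) ?bvol_clip_le//; apply/rowP => i; rewrite !mxE minC.
by apply/rowP => i; rewrite !mxE maxC.
Qed.

End RationalBoxes.

(** * From distribution functions to Borel measures *)

Lemma row_bounded (K : archiRealFieldType) n (s : 'rV[K]_n) :
  exists k : nat, forall i, `|s 0 i| < k%:R.
Proof.
pose h i := (Num.trunc `|s 0 i|).+1; exists (\max_i h i)%N => i.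
by apply: lt_le_trans (truncnS_gt _) _; rewrite ler_nat; exact: (leq_bigmax i).
Qed.

Section Boxes.
Variables (R : realType) (n : nat).

Definition box (a b : 'rV[rat]_n) : set 'rV[R]_n :=
  [set s | forall i, ratr (a 0 i) <= s 0 i < ratr (b 0 i)].

Definition orthant (t : 'rV[R]_n) : set 'rV[R]_n :=
  [set s : 'rV[R]_n | forall i : 'I_n, s 0 i < t 0 i].

Definition halfspace (i : 'I_n) (x : R) : set 'rV[R]_n := [set s | s 0 i < x].

Definition ratv (q : 'rV[rat]_n) : 'rV[R]_n := map_mx ratr q.

Lemma open_pi (A : 'I_n -> set R) : (forall i, open (A i)) ->
  open [set s : 'rV[R]_n | forall i, A i (s 0 i)].
Proof.
move=> oA; rewrite openE => s /= hs; exists (fun _ i => A i).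
  move=> k i; have := oA i; rewrite openE; apply.
  by rewrite (ord1 k); exact: hs.
by move=> t /= ht i; exact: ht.
Qed.

Lemma open_orthant t : open (orthant t).
Proof. by apply: (@open_pi (fun i => [set x : R | x < t 0 i])) => i; exact: open_lt. Qed.

Let T := g_sigma_algebraType [set A : set 'rV[R]_n | open A].

Lemma borelT : borel [set: 'rV[R]_n].
Proof. by apply: sub_sigma_algebra; exact: openT. Qed.

Lemma borel_orthant t : borel (orthant t).
Proof. by apply: sub_sigma_algebra => /=; apply: open_orthant. Qed.

Lemma borelD (A B : set 'rV[R]_n) : borel A -> borel B -> borel (A `\` B).
Proof. exact: (@measurableD _ T). Qed.

Lemma borelU (A B : set 'rV[R]_n) : borel A -> borel B -> borel (A `|` B).
Proof. exact: (@measurableU _ T). Qed.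

Lemma borel_bigcup (A : nat -> set 'rV[R]_n) :
  (forall k, borel (A k)) -> borel (\bigcup_k A k).
Proof. by move=> bA; apply: (@bigcup_measurable _ T) => k _; exact: bA. Qed.

End Boxes.
Arguments box R {n} a b.
Arguments ratv R {n} q.

Definition lower (K : numFieldType) n (k : nat) (t : 'rV[K]_n) : 'rV[K]_n :=
  \row_i (t 0 i - k.+1%:R^-1).

Lemma lower_ll (R : realType) n k (t : 'rV[R]_n) : ll (lower k t) t.
Proof. by move=> i; rewrite mxE gtrBl invr_gt0 ltr0n. Qed.

Lemma lower_approx (R : realType) n (s t : 'rV[R]_n) : ll s t ->
  exists k, ll s (lower k t).
Proof.
move=> st; have /choice[h hh] : forall i, exists k, forall m, (k <= m)%N ->
    s 0 i < t 0 i - m.+1%:R^-1.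
  move=> i; have d0 : 0 < t 0 i - s 0 i by rewrite subr_gt0.
  have [k _ hk] := near_infty_natSinv_lt (PosNum d0).
  by exists k => m /hk /=; rewrite ltrBrDr -ltrBrDl.
by exists (\max_i h i)%N => i; rewrite mxE; apply: hh; exact: leq_bigmax.
Qed.

Section RealMeasure.
Variables (R : realType) (n : nat) (f : 'rV[rat]_n -> R).
Implicit Types (a b c d s t : 'rV[rat]_n) (i j : 'I_n).

(** Only rational points occur, hence countably many conditions. Left limits are asked along the
    single sequence [lower k t]; monotonicity yields the others. *)
Record distribution_function : Prop := {
  distr_vol : forall a b, 0 <= bvol f a b ;
  distr_ge0 : forall t, 0 <= f t ;
  distr_mono : forall s t, (forall i, s 0 i <= t 0 i) -> f s <= f t ;
  distr_left : forall t, (fun k => f (lower k t)) @ \oo --> f t ;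
  distr_bot : forall t i, (fun k : nat => f (setc t i (- k%:R))) @ \oo --> (0 : R)
}.

Hypothesis df : distribution_function.

(** Squeezed between [lower k t] and [t]: a class of sequences stable under the coordinate changes
    of [vol], which mix constant and lowered coordinates. *)
Definition near_left (tk : nat -> 'rV[rat]_n) t :=
  forall k i, t 0 i - k.+1%:R^-1 <= tk k 0 i <= t 0 i.

Lemma invS_ge0 k : 0 <= k.+1%:R^-1 :> rat. Proof. by rewrite invr_ge0. Qed.

Lemma near_left_cst t : near_left (fun=> t) t.
Proof. by move=> k i; rewrite lexx gerBl invS_ge0. Qed.

Lemma near_left_lower t : near_left (fun k => lower k t) t.
Proof. by move=> k i; rewrite mxE lexx gerBl invS_ge0. Qed.

Lemma near_left_setc tk t uk u i : near_left tk t -> near_left uk u ->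
  near_left (fun k => setc (tk k) i (uk k 0 i)) (setc t i (u 0 i)).
Proof. by move=> ht hu k j; rewrite !setcE; case: (j == i). Qed.

Lemma near_left_vmax tk t uk u : near_left tk t -> near_left uk u ->
  near_left (fun k => vmax (tk k) (uk k)) (vmax t u).
Proof.
move=> ht hu k j; rewrite !mxE; have /andP[t1 t2] := ht k j; have /andP[u1 u2] := hu k j.
rewrite ge_max !le_max t2 u2 orbT andbT.
by have [_|_] := leP (t 0 j) (u 0 j); rewrite ?t1 ?u1 ?orbT.
Qed.

Lemma near_left_cvg tk t : near_left tk t -> (fun k => f (tk k)) @ \oo --> f t.
Proof.
move=> ht; apply: squeeze_cvgr (distr_left df (t := t)) (cvg_cst (f t)).
apply: nearW => k; rewrite !(distr_mono df)// => i; have /andP[//] := ht k i.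
by rewrite mxE.
Qed.

Lemma vol_cvg ak a bk b l tk t : near_left ak a -> near_left bk b -> near_left tk t ->
  (fun k => vol f (ak k) (bk k) l (tk k)) @ \oo --> vol f a b l t.
Proof.
move=> ha hb; elim: l tk t => [|i l IH] tk t ht; first exact: near_left_cvg.
rewrite vol_cons; under eq_fun do rewrite vol_cons.
by apply: cvgB; apply: IH; exact: near_left_setc.
Qed.

Lemma bvol_cvg ak a bk b : near_left ak a -> near_left bk b ->
  (fun k => bvol f (ak k) (bk k)) @ \oo --> bvol f a b.
Proof. by move=> ha hb; apply: vol_cvg => //; exact: near_left_vmax. Qed.

Lemma bvol_dist ak a bk b e : near_left ak a -> near_left bk b -> 0 < e ->
  exists k, `|bvol f a b - bvol f (ak k) (bk k)| < e.
Proof.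
move=> ha hb e0; have /cvgr_dist_lt/(_ _ e0)[k _ hk] := bvol_cvg ha hb.
by exists k; apply: hk => /=.
Qed.

(** The compactness argument of Lebesgue-Stieltjes measure. Lowering [b] makes the covered box
    compact, lowering each [c k] makes the covering boxes open, and left continuity controls both
    errors. *)
Lemma bvol_sigma_subadditive a b (c d : nat -> 'rV[rat]_n) :
  box R a b `<=` \bigcup_k box R (c k) (d k) ->
  ((bvol f a b)%:E <= \sum_(k <oo) (bvol f (c k) (d k))%:E)%E.
Proof.
move=> cov; apply/lee_addgt0Pr => e e0.
have e2 : 0 < e / 2 by rewrite divr_gt0.
have [m hm] := bvol_dist (near_left_cst a) (near_left_lower b) e2.
have /choice[h hh] : forall k, exists r, `|bvol f (c k) (d k) - bvol f (lower r (c k)) (d k)|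
    < e / 2 / (2 ^ k.+1)%:R.
  move=> k; apply: (bvol_dist (near_left_lower (c k)) (near_left_cst (d k))).
  by rewrite divr_gt0// ltr0n expn_gt0.
pose c' k := lower (h k) (c k).
have ltl k (t : 'rV[rat]_n) i : lower k t 0 i < t 0 i by rewrite mxE gtrBl invr_gt0 ltr0n.
pose Kc := [set v : 'rV[R]_n | forall i,
  `[ratr (a 0 i), ratr (lower m b 0 i)]%classic (v ord0 i)].
pose U k := [set s : 'rV[R]_n | forall i, `]ratr (c' k 0 i), ratr (d k 0 i)[%classic (s 0 i)].
have cKc : compact Kc.
  have := @rV_compact R n (fun i => `[ratr (a 0 i), ratr (lower m b 0 i)]%classic).
  by move=> HH; refine (HH _) => i; exact: segment_compact.
have [D _ KD] : finite_subset_cover setT U Kc.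
  rewrite compact_cover in cKc; apply: cKc => [k _|s Ks].
    apply: (@open_pi _ _ (fun i => `]ratr (c' k 0 i), ratr (d k 0 i)[%classic)) => i.
    exact: interval_open.
  have [|k _ kbox] := cov s.
    move=> i; have := Ks i; rewrite /= in_itv /= => /andP[-> /= sb].
    by apply: le_lt_trans sb _; rewrite ltr_rat; exact: ltl.
  exists k => // i; have /andP[h1 h2] := kbox i; rewrite /= in_itv /= h2 andbT.
  by apply: lt_le_trans h1; rewrite ltr_rat; exact: ltl.
have [N hN] : exists N, forall k : nat, k \in (finmap.enum_fset D : seq nat) -> (k < N)%N.
  by exists (\max_(k <- finmap.enum_fset D) k).+1 => k kD; rewrite ltnS leq_bigmax_seq.
have fin : bvol f a (lower m b) <= \sum_(0 <= k < N) bvol f (c' k) (d k).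
  apply: le_trans (@bvol_finite_subadditive _ _ _ (distr_vol df)
    [seq (c' k, d k) | k <- index_iota 0 N] _ _ _) _.
    (* Finite subadditivity tests a cover at rational points only, so the real cover is restricted
       to them. *)
    move=> s /forallP hs; have [|k /= kD ks] := KD (ratv R s).
      move=> i; rewrite /= in_itv /= !mxE; have /andP[h1] := hs i.
      by rewrite mxE => h2; rewrite !ler_rat h1 ltW.
    exists (c' k, d k).
      by apply/mapP; exists k; rewrite // mem_index_iota hN.
    apply/forallP => i; have := ks i; rewrite /= in_itv /= [ratv R s 0 i]mxE !ltr_rat.
    by move=> /andP[/ltW-> ->].
  by rewrite big_map.
have A0 k : (0 <= (bvol f (c k) (d k))%:E)%E by rewrite lee_fin (distr_vol df).
apply: (@le_trans _ _ ((bvol f a (lower m b))%:E + (e / 2)%:E)%E).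
  rewrite -EFinD lee_fin -lerBlDl; apply: le_trans (ler_norm _) (ltW hm).
rewrite [in leRHS](splitr e) EFinD addeA leeD2r//.
apply: le_trans (epsilon_trick xpredT A0 (ltW e2)).
apply: (@le_trans _ _ (\sum_(0 <= k < N)
    ((bvol f (c k) (d k))%:E + (e / 2 / (2 ^ k.+1)%:R)%:E)%E)); last first.
  apply: nneseries_lim_ge => k _ _; rewrite adde_ge0// lee_fin divr_ge0 ?ltW//.
under eq_bigr do rewrite -EFinD.
rewrite sumEFin lee_fin; apply: le_trans fin _; apply: ler_sum => k _.
rewrite -lerBlDl; apply: le_trans (ler_norm _) _.
by rewrite distrC; exact: ltW (hh k).
Qed.

End RealMeasure.

(** * Rational orthants generate the Borel sets *)

Section BorelGenerators.
Variables (R : realType) (n : nat).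

Definition rational_orthants : set (set 'rV[R]_n) := range (fun q => orthant (ratv R q)).

Let T := g_sigma_algebraType rational_orthants.

Let measurable_halfspace i (x : rat) : measurable (halfspace i (ratr x) : set T).
Proof.
rewrite (_ : halfspace _ _ = \bigcup_k orthant (ratv R (setc (const_mx k%:R) i x))).
  apply: bigcup_measurable => k _; apply: sub_sigma_algebra.
  by exists (setc (const_mx k%:R) i x).
apply/seteqP; split => [s /= si|s [k _ /(_ i)]]; last by rewrite !mxE eqxx.
have [k hk] := row_bounded s.
exists k => // j; rewrite !mxE; case: eqP => [->//|_].
by rewrite ratr_nat; apply: le_lt_trans (ler_norm _) (hk j).
Qed.

Lemma measurable_box a b : <<s rational_orthants >> (box R a b).
Proof.
rewrite (_ : box R a b = \bigcap_(i in [set: 'I_n])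
    (halfspace i (ratr (b 0 i)) `&` ~` halfspace i (ratr (a 0 i)))).
  apply: (@fin_bigcap_measurable _ T) => [|i _]; first exact: finite_finset.
  by apply: measurableI; [|apply: measurableC].
apply/seteqP; split => s hs i; last first.
  by have [//|/= -> /negP] := hs i; rewrite -leNgt andbT.
by move=> _; have /andP[h1 h2] := hs i; split => //=; apply/negP; rewrite -leNgt.
Qed.

(** An open set is the union of the countably many rational boxes that it contains. *)
Lemma borel_rational_orthants : @borel R n = <<s rational_orthants >>.
Proof.
apply/seteqP; split; last first.
  apply: smallest_sub; first exact: smallest_sigma_algebra.
  by move=> _ [q _ <-]; exact: borel_orthant.
apply: smallest_sub; first exact: smallest_sigma_algebra.
move=> A oA.
pose B k : set T := if unpickle k is Some ab then
  (if pselect (box R ab.1 ab.2 `<=` A) then box R ab.1 ab.2 else set0) else set0.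
suff -> : A = \bigcup_k B k.
  apply: (@bigcup_measurable _ T) => k _; rewrite /B.
  case: unpickle => [ab|]; last exact: measurable0.
  by case: pselect => ?; [exact: measurable_box | exact: measurable0].
apply/seteqP; split => [s As|s [k _]]; last first.
  rewrite /B; case: unpickle => [ab|//].
  by case: pselect => // h; exact: h.
have := oA; rewrite openE => /(_ s As) [P hP PA].
have /choice[ab hab] : forall i, exists ab : rat * rat,
    ratr ab.1 <= s 0 i < ratr ab.2 /\ forall x, ratr ab.1 <= x < ratr ab.2 -> P 0 i x.
  move=> i; have /nbhs_ballP[e /= e0 he] := hP 0 i.
  have [|p] := @rat_in_itvoo R (s 0 i - e) (s 0 i); first by rewrite gtrBl.
  rewrite in_itv /= => /andP[p1 p2].
  have [|q] := @rat_in_itvoo R (s 0 i) (s 0 i + e); first by rewrite ltrDl.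
  rewrite in_itv /= => /andP[q1 q2].
  exists (p, q) => /=; split; first by rewrite (ltW p2) q1.
  move=> x /andP[x1 x2]; apply: he; rewrite /ball /= ltr_distlC.
  by rewrite (lt_le_trans p1 x1) (lt_trans x2 q2).
pose a : 'rV[rat]_n := \row_i (ab i).1; pose b : 'rV[rat]_n := \row_i (ab i).2.
exists (pickle (a, b)) => //; rewrite /B pickleK /=.
case: pselect => [_ i|]; first by rewrite !mxE; have [] := hab i.
case=> t ht; apply: PA => k i; rewrite (ord1 k).
by apply: (hab i).2; have := ht i; rewrite !mxE.
Qed.

End BorelGenerators.

(** * The outer measure of a distribution function *)

Section BoxOuterMeasure.
Variables (R : realType) (n : nat) (f : 'rV[rat]_n -> R).
Implicit Types (A : set 'rV[R]_n).

(** The absolute value and the separate case of [set0] make this a valid cost for every [f] and [n],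
    so that the outer measure below is a canonical instance without hypotheses. *)
Definition box_cost A : \bar R := if pselect (A = set0) then 0%E else
  ereal_inf [set x | exists a b, A `<=` box R a b /\ x = `|bvol f a b|%:E].

Lemma box_cost0 : box_cost set0 = 0%E.
Proof. by rewrite /box_cost; case: pselect. Qed.

Lemma box_cost_ge0 A : (0 <= box_cost A)%E.
Proof.
rewrite /box_cost; case: pselect => // ?.
by apply: le_ereal_inf_tmp => _ [a [b [_ ->]]]; rewrite lee_fin.
Qed.

(** Covers by arbitrary sets are allowed; a set contained in no rational box
    costs [+oo]. *)
Definition discrete_rV := g_sigma_algebraType [set: set 'rV[R]_n].

Definition box_measure : set discrete_rV -> \bar R :=
  @mu_ext _ discrete_rV R box_cost.

HB.instance Definition _ := isOuterMeasure.Build R discrete_rV box_measure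
  (@mu_ext0 _ discrete_rV R box_cost box_cost0 box_cost_ge0)
  (@mu_ext_ge0 _ discrete_rV R box_cost box_cost_ge0)
  (@le_mu_ext _ discrete_rV R box_cost)
  (@mu_ext_sigma_subadditive _ discrete_rV R box_cost box_cost_ge0).

Lemma box_measure_le A (B : nat -> set 'rV[R]_n) : A `<=` \bigcup_k B k ->
  (box_measure A <= \sum_(k <oo) box_cost (B k))%E.
Proof.
move=> AB; apply: ereal_inf_lbound; exists B => //; split => // i.
exact: sub_sigma_algebra.
Qed.

End BoxOuterMeasure.

Section DistributionMeasure.
Variables (R : realType) (n : nat) (f : 'rV[rat]_n -> R).
Hypotheses (n0 : (0 < n)%N) (df : distribution_function f).
Implicit Types (A B X : set 'rV[R]_n) (a b q : 'rV[rat]_n).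
Local Notation mu := (box_measure f).

Let i0 := Ordinal n0.

Lemma box_cost_le A a b : A `<=` box R a b -> (box_cost f A <= (bvol f a b)%:E)%E.
Proof.
move=> Aab; rewrite /box_cost; case: pselect => ?; first by rewrite lee_fin (distr_vol df).
apply: ereal_inf_lbound; exists a, b; split => //.
by rewrite ger0_norm// (distr_vol df).
Qed.

Lemma box_costP A (e : R) : 0 < e -> box_cost f A != +oo%E ->
  exists ab : 'rV[rat]_n * 'rV[rat]_n, A `<=` box R ab.1 ab.2 /\
    ((bvol f ab.1 ab.2)%:E <= box_cost f A + e%:E)%E.
Proof.
move=> e0; rewrite /box_cost; case: pselect => [A0|?] Aoo.
  (* A degenerate box; it has volume 0 because there is at least one coordinate. *)
  exists (0, 0); split; first by rewrite A0.
  by rewrite (@bvol0 _ _ _ _ _ i0)// add0e lee_fin ltW.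
set S := [set x | _] in Aoo *.
have Sfin : ereal_inf S \is a fin_num.
  rewrite fin_numE Aoo andbT -ltNye; apply: (@lt_le_trans _ _ 0%E); first by [].
  by apply: le_ereal_inf_tmp => _ [a [b [_ ->]]]; rewrite lee_fin.
have [x [a [b [Aab ->]]] /ltW xe] := lb_ereal_inf_adherent e0 Sfin.
by exists (a, b); split => //; apply: le_trans xe; rewrite lee_fin ler_norm.
Qed.

Lemma box_measure_box a b : mu (box R a b) = (bvol f a b)%:E.
Proof.
apply/eqP; rewrite eq_le; apply/andP; split.
  apply: le_trans (box_measure_le f (B := fun k => if k is 0%N then box R a b else set0) _) _.
    by move=> s hs; exists 0%N.
  rewrite nneseries_recl//; last by move=> k _; exact: box_cost_ge0.
  rewrite eseries_cond/= eseries0 ?adde0 ?box_cost_le//.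
  by move=> [|k]// _ _; exact: box_cost0.
apply: le_ereal_inf_tmp => _ [B [_ cov] <-].
have [[k ioo]|] := pselect (exists k, box_cost f (B k) = +oo%E).
  rewrite (eseries_pinfty _ _ ioo) ?leey// => m _.
  by rewrite -ltNye (lt_le_trans _ (box_cost_ge0 f _)).
move=> /forallNP Boo; apply/lee_addgt0Pr => e e0.
have /choice[cd hcd] : forall k, exists ab : 'rV[rat]_n * 'rV[rat]_n,
    B k `<=` box R ab.1 ab.2 /\
    ((bvol f ab.1 ab.2)%:E <= box_cost f (B k) + (e / (2 ^ k.+1)%:R)%:E)%E.
  by move=> k; apply: box_costP; [rewrite divr_gt0// ltr0n expn_gt0 | apply/eqP].
apply: le_trans (epsilon_trick xpredT (fun k => box_cost_ge0 f (B k)) (ltW e0)).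
apply: le_trans (@bvol_sigma_subadditive _ _ _ df a b (fst \o cd) (snd \o cd) _) _.
  by apply: subset_trans cov _ => s [k _ ks]; exists k => //; apply: (hcd k).1.
apply: lee_nneseries => [k _ _|k _]; first by rewrite lee_fin (distr_vol df).
exact: (hcd k).2.
Qed.

(** A rational hyperplane cuts each covering box into two boxes whose volumes add up, so the
    Carathéodory inequality holds already for the cost. *)
Lemma box_cost_halfspace A i (x : rat) :
  (box_cost f (A `&` halfspace i (ratr x)) + box_cost f (A `&` ~` halfspace i (ratr x))
    <= box_cost f A)%E.
Proof.
rewrite {3}/box_cost; case: pselect => [A0|?] /=.
  by rewrite A0 !set0I box_cost0 adde0.
apply: le_ereal_inf_tmp => _ [a [b [Aab ->]]].
rewrite ger0_norm ?(distr_vol df)// (bvol_clip _ _ _ i x) EFinD; apply: leeD.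
  apply: box_cost_le => s [/Aab hs sx] j; have /andP[h1 h2] := hs j.
  rewrite h1 setcE; case: eqP => // E; rewrite E in h1 h2 *.
  by rewrite /Num.min; case: ifP.
apply: box_cost_le => s [/Aab hs sx] j; have /andP[h1 h2] := hs j.
rewrite h2 andbT setcE; case: eqP => // E; rewrite E in h1 h2 *.
by rewrite /Num.max; case: ifP => // _; rewrite leNgt; apply/negP.
Qed.

Lemma caratheodory_halfspace i (x : rat) : mu.-caratheodory (halfspace i (ratr x)).
Proof.
apply: le_caratheodory_measurable => X.
apply: le_ereal_inf_tmp => _ [B [_ cov] <-].
apply: (@le_trans _ _ (\sum_(k <oo) (box_cost f (B k `&` halfspace i (ratr x)) +
    box_cost f (B k `&` ~` halfspace i (ratr x))))%E); last first.
  apply: lee_nneseries => [k _ _|k _]; first by rewrite adde_ge0 ?box_cost_ge0.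
  exact: box_cost_halfspace.
rewrite nneseriesD => [|k _ _|k _ _]; try exact: box_cost_ge0.
by apply: leeD; apply: box_measure_le => s [/cov[k _ ks] sx]; exists k.
Qed.

Lemma borel_caratheodory A : borel A -> mu.-caratheodory A.
Proof.
rewrite borel_rational_orthants.
apply: (@smallest_sub _ (sigma_algebra setT)) => [|_ [q _ <-]].
  split; first exact: caratheodory_measurable_set0.
    by move=> B; rewrite setTD; exact: caratheodory_measurable_setC.
  exact: caratheodory_measurable_bigcup.
rewrite (_ : orthant _ = \bigcap_(i in [set: 'I_n]) halfspace i (ratr (q 0 i))).
  apply: (@fin_bigcap_measurable _ (caratheodory_type mu)) => [|i _].
    exact: finite_finset.
  exact: caratheodory_halfspace.
apply/seteqP; split => s hs i; first by move=> _; have := hs i; rewrite mxE.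
by rewrite mxE; exact: hs.
Qed.

Lemma box_measureU A B : borel A -> borel B -> A `&` B = set0 ->
  mu (A `|` B) = (mu A + mu B)%E.
Proof.
move=> bA bB AB.
pose om : {outer_measure set (discrete_rV R n) -> \bar R} := box_measure f.
exact: (@measureU _ R (caratheodory_type om) om A B
  (borel_caratheodory bA) (borel_caratheodory bB) AB).
Qed.

Lemma box_measure_cvg (A : nat -> set 'rV[R]_n) : (forall k, borel (A k)) ->
  nondecreasing_seq A -> mu \o A @ \oo --> mu (\bigcup_k A k).
Proof.
pose om : {outer_measure set (discrete_rV R n) -> \bar R} := box_measure f.
move=> bA ndA; apply: (@nondecreasing_cvg_mu _ (caratheodory_type om) R om) => //.
  by move=> k; exact: borel_caratheodory.
by apply: caratheodory_measurable_bigcup => k; exact: borel_caratheodory.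
Qed.

(** The volume expands into [2 ^ size l] values of [f], all at points below [m] whose [i]-th
    coordinate is at most [- k%:R]. *)
Lemma vol_abs_le a b (l : seq 'I_n) i (k : nat) (m t : 'rV[rat]_n) :
  i \notin l -> t 0 i <= - k%:R ->
  (forall j, [/\ t 0 j <= m 0 j, a 0 j <= m 0 j & b 0 j <= m 0 j]) ->
  `|vol f a b l t| <= (2 ^ size l)%:R * f (setc m i (- k%:R)).
Proof.
elim: l t => [|j l IH] t il ti hm.
  rewrite mul1r ger0_norm ?(distr_ge0 df)//; apply: (distr_mono df) => j.
  by rewrite setcE; case: eqP => [->//|_]; have [] := hm j.
move: il; rewrite inE negb_or => /andP[ij il].
rewrite vol_cons /= expnS mul2n -addnn natrD mulrDl.
apply: le_trans (ler_normB _ _) (lerD _ _); apply: IH => //.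
- by rewrite setcE (negbTE ij).
- by move=> p; have [h1 h2 h3] := hm p; rewrite setcE; case: eqP => [E|//]; rewrite -E.
- by rewrite setcE (negbTE ij).
- by move=> p; have [h1 h2 h3] := hm p; rewrite setcE; case: eqP => [E|//]; rewrite -E.
Qed.

(** Every term of the expansion that involves a lower corner tends to 0; only the value at the upper
    corner survives. *)
Lemma vol_cvg_bot b (l : seq 'I_n) (t : 'rV[rat]_n) : uniq l ->
  (fun k : nat => vol f (const_mx (- k%:R)) b l t) @ \oo -->
  f (\row_i if i \in l then b 0 i else t 0 i).
Proof.
elim: l t => [|i l IH] t /=.
  by move=> _; rewrite (_ : \row_i _ = t); [exact: cvg_cst | apply/rowP => i; rewrite mxE].
move=> /andP[il ul]; under eq_fun do rewrite vol_cons.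
have c1 := IH (setc t i (b 0 i)) ul.
rewrite (_ : \row_i _ = \row_j if j \in i :: l then b 0 j else t 0 j) in c1; last first.
  apply/rowP => j; rewrite !mxE inE; have [->|//] := eqVneq j i.
  by case: (i \in l).
suff c2 : (fun k : nat => vol f (const_mx (- k%:R)) b l
    (setc t i ((const_mx (- k%:R) : 'rV[rat]_n) 0 i))) @ \oo --> (0 : R).
  by have := cvgB c1 c2; rewrite subr0; apply.
pose m := vmax (vmax b t) 0.
have hm (k : nat) j : [/\ setc t i (- k%:R) 0 j <= m 0 j, - k%:R <= m 0 j & b 0 j <= m 0 j].
  have kn : - k%:R <= m 0 j by rewrite /m !mxE le_max orbC oppr_le0 ler0n.
  split => //; last by rewrite !mxE !le_max lexx.
  by rewrite setcE; case: eqP => // _; rewrite !mxE !le_max lexx orbT.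
apply/norm_cvg0P.
have bd (k : nat) : `|vol f (const_mx (- k%:R)) b l
      (setc t i ((const_mx (- k%:R) : 'rV[rat]_n) 0 i))|
    <= (2 ^ size l)%:R * f (setc m i (- k%:R)).
  rewrite mxE; apply: vol_abs_le => //; first by rewrite setcE eqxx.
  by move=> j; have [h1 h2 h3] := hm k j; split; rewrite // mxE.
have c0 : (fun k : nat => (2 ^ size l)%:R * f (setc m i (- k%:R))) @ \oo --> (0 : R).
  have := cvgM (cvg_cst ((2 ^ size l)%:R : R)) (@distr_bot _ _ _ df m i).
  by rewrite mulr0; apply.
apply: squeeze_cvgr (cvg_cst (0 : R)) c0; apply: nearW => k.
by rewrite normr_ge0 bd.
Qed.

Lemma box_measure_orthant q : mu (orthant (ratv R q)) = (f q)%:E.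
Proof.
have -> : orthant (ratv R q) = \bigcup_k box R (const_mx (- k%:R)) q.
  apply/seteqP; split => [s hs|s [k _ ks] i]; last by have /andP[_] := ks i; rewrite mxE.
  have [k hk] := row_bounded s.
  exists k => // j; apply/andP; split; last by have := hs j; rewrite mxE.
  rewrite mxE rmorphN /= ratr_nat; have := hk j.
  by rewrite ltr_norml => /andP[/ltW].
have bb a b : borel (box R a b).
  rewrite borel_rational_orthants; exact: measurable_box.
have := @box_measure_cvg (fun k => box R (const_mx (- k%:R)) q) (fun k => bb _ _).
have nd : nondecreasing_seq (fun k : nat => box R (const_mx (- k%:R)) q).
  move=> k m km; apply/subsetPset => s hs i; have /andP[h1 ->] := hs i.
  rewrite andbT; apply: le_trans h1; rewrite !mxE !rmorphN /= !ratr_nat.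
  by rewrite lerN2 ler_nat.
move=> /(_ nd) c1.
have c2 : (fun k : nat => (bvol f (const_mx (- k%:R)) q)%:E) @ \oo --> (f q)%:E.
  apply/fine_cvgP; split; first by apply: nearW.
  have := @vol_cvg_bot q (enum 'I_n) q (enum_uniq _).
  rewrite (_ : \row_i _ = q); last by apply/rowP => i; rewrite mxE; case: ifP.
  apply: cvg_trans; apply: near_eq_cvg.
  have [m hm] := row_bounded q.
  exists m => // k /= mk.
  rewrite /bvol (volT _ _ _ _ q); apply: eq_vol => // i _; rewrite !mxE max_r//.
  have := hm i; rewrite ltr_norml => /andP[/ltW + _]; apply: le_trans.
  by rewrite lerN2 ler_nat.
apply: (cvg_unique _ c1) => //; apply: cvg_trans c2; apply: near_eq_cvg.
by apply: nearW => k /=; rewrite box_measure_box.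
Qed.

End DistributionMeasure.

(** * Measures with values in a lattice-ordered group *)

(** Suprema and infima are expressed by bounds [w] along sequences, the form in which generic
    functionals preserve them; [u] is the total mass. *)
Record group_distribution (R : realType) (n : nat) (G : lgroupType) (u : G)
    (F : 'rV[R]_n -> G) : Prop := {
  gd_vol : forall a b t : 'rV[R]_n, (forall i, a 0 i <= b 0 i) ->
    0 <= vol F a b (enum 'I_n) t ;
  gd_ge0 : forall t, 0 <= F t ;
  gd_le : forall t, F t <= u ;
  gd_mono : forall s t : 'rV[R]_n, (forall i, s 0 i <= t 0 i) -> F s <= F t ;
  gd_left : forall t w, (forall k, F (lower k t) <= w) -> F t <= w ;
  gd_bot : forall t i w, (forall k : nat, w <= F (setc t i (- k%:R))) -> w <= 0 ;
  gd_top : forall w, (forall k : nat, F (const_mx k%:R) <= w) -> u <= w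
}.

Lemma ratv_orthantI (R : realType) n (q r : 'rV[rat]_n) :
  orthant (ratv R (vmin q r)) = orthant (ratv R q) `&` orthant (ratv R r).
Proof.
apply/seteqP; split => [s hs|s [h1 h2] i].
  have h i : s 0 i < ratr (q 0 i) /\ s 0 i < ratr (r 0 i).
    have := hs i; rewrite !mxE; have [qr|/ltW qr] := leP (q 0 i) (r 0 i) => sx;
      by split => //; apply: lt_le_trans sx _; rewrite ler_rat.
  by split => i; rewrite mxE; case: (h i).
have := h1 i; have := h2 i; rewrite !mxE.
by case: (leP (q 0 i) (r 0 i)).
Qed.

Section GroupMeasure.
Variables (R : realType) (n : nat) (G : lgroupType) (u : G) (F : 'rV[R]_n -> G).
Hypotheses (n0 : (0 < n)%N) (hG : dedekind_sigma_complete G)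
  (hF : group_distribution u F).
Implicit Types (p : nat -> G) (A B : set 'rV[R]_n) (g : G).

Let u0 : 0 <= u.
Proof. exact: le_trans (gd_ge0 hF 0) (gd_le hF 0). Qed.

Let ubF t : ub u (F t).
Proof. by apply: ub01 => //; [exact: (gd_ge0 hF) | exact: (gd_le hF)]. Qed.

Let phi p g : R := phi R u p g.

Definition chain_distr p (q : 'rV[rat]_n) : R := phi p (F (ratv R q)).

Lemma ratv_setc (t : 'rV[rat]_n) i x : ratv R (setc t i x) = setc (ratv R t) i (ratr x).
Proof. by apply/rowP => j; rewrite !mxE; case: (j == i). Qed.

Lemma ratv_lower (t : 'rV[rat]_n) k : ratv R (lower k t) = lower k (ratv R t).
Proof.
apply/rowP => j; rewrite !mxE rmorphB fmorphV; congr (_ - _^-1).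
exact: ratr_nat.
Qed.

Lemma vol_ratv (V : zmodType) (h : 'rV[R]_n -> V) (a b : 'rV[rat]_n) l t :
  vol (h \o ratv R) a b l t = vol h (ratv R a) (ratv R b) l (ratv R t).
Proof. by elim: l t => [//|i l IH] t; rewrite !vol_cons !IH !ratv_setc !mxE. Qed.

Let ub_vol a b l t : ub u (vol F a b l t).
Proof. by elim: l t => [|i l IH] t; [exact: ubF | rewrite vol_cons; apply: ubB]. Qed.

(** Rational corners and finite lists of coordinates form a countable type, so additivity on all
    partial volumes and all the limits can be imposed on one chain. *)
Lemma aeg_chain_distr : aeg u (fun p => distribution_function (chain_distr p)).
Proof.
have hadd : aeg u (fun p =>
    forall x : 'rV[rat]_n * 'rV[rat]_n * seq 'I_n * 'rV[rat]_n * 'rV[rat]_n,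
    let: (a, b, l, t, t') := x in
    phi p (vol (F \o ratv R) a b l t - vol (F \o ratv R) a b l t') =
    phi p (vol (F \o ratv R) a b l t) - phi p (vol (F \o ratv R) a b l t')).
  apply: aeg_all => -[[[[a b] l] t] t'].
  by apply: aeg_phiB => //; rewrite vol_ratv; exact: ub_vol.
have hleft : aeg u (fun p => forall t,
    (fun k => chain_distr p (lower k t)) @ \oo --> chain_distr p t).
  apply: aeg_all => t; apply: (@aeg_phi_sup _ _ _ u0 (fun k => F (ratv R (lower k t)))) => //.
  - move=> j k jk; apply: (gd_mono hF) => i.
    rewrite !mxE ler_rat lerD2l lerN2 lef_pV2 ?posrE ?ltr0n// ler_nat ltnS//.
  - by move=> j; apply: (gd_mono hF) => i; rewrite !mxE ler_rat gerBl invr_ge0.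
  - move=> w hw; apply: (gd_left hF) => k; have := hw k.
    by rewrite ratv_lower.
have hbot : aeg u (fun p => forall ti : 'rV[rat]_n * 'I_n,
    (fun k : nat => chain_distr p (setc ti.1 ti.2 (- k%:R))) @ \oo --> (0 : R)).
  apply: aeg_all => -[t i].
  have e1 : aeg u (fun p => forall k : nat, phi p (- F (ratv R (setc t i (- k%:R)))) =
      - phi p (F (ratv R (setc t i (- k%:R))))).
    by apply: aeg_all => k; exact: aeg_phiN.
  (* The limit at minus infinity is an infimum; it is treated as a supremum of opposites. *)
  have e2 : aeg u (fun p => (fun k : nat => phi p (- F (ratv R (setc t i (- k%:R))))) @ \oo
      --> phi p 0).
    apply: (@aeg_phi_sup _ _ _ u0 (fun k : nat => - F (ratv R (setc t i (- k%:R))))).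
    - by move=> j; exact: ubN.
    - exact: ub01.
    - move=> j k jk; rewrite lg_leN2; apply: (gd_mono hF) => m.
      by rewrite !mxE; case: eqP => // _; rewrite ler_rat lerN2 ler_nat.
    - by move=> j; rewrite lg_oppr_le0; exact: (gd_ge0 hF).
    - move=> w hw; rewrite -lg_oppr_le0; apply: (@gd_bot _ _ _ _ _ hF (ratv R t) i) => k.
      have := hw k; rewrite -lg_leN2 opprK ratv_setc rmorphN /= ratr_nat.
      exact.
  apply: aeg_imp (aeg_and e1 e2) => p cp [h1 h2] /=.
  have -> : (fun k : nat => chain_distr p (setc t i (- k%:R))) =
      (fun k : nat => - phi p (- F (ratv R (setc t i (- k%:R))))).
    by apply/funext => k; rewrite h1 opprK.
  by have := cvgN h2; rewrite /phi (phi0 _ u0 cp) oppr0; exact.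
apply: aeg_imp (aeg_and hadd (aeg_and hleft hbot)) => p cp [h1 [h2 h3]].
split => //.
- move=> a b; rewrite /bvol.
  rewrite -(@vol_map _ _ _ _ (phi p) (F \o ratv R)); last first.
    by move=> l t t'; exact: h1 (a, vmax a b, l, t, t').
  apply: phi_ge0 => //; first by rewrite vol_ratv.
  by rewrite vol_ratv; apply: (gd_vol hF) => i; rewrite !mxE ler_rat le_max lexx.
- by move=> t; apply: phi_ge0 => //; exact: (gd_ge0 hF).
- by move=> s t st; apply: phi_mono => //; apply: (gd_mono hF) => i; rewrite !mxE ler_rat.
- by move=> t i; exact: (h3 (t, i)).
Qed.

(** The dense sets hidden in [aeg] may depend on [A], but one [g] serves all chains that meet
    them. *)
Definition represents_measure A g := [/\ 0 <= g, g <= u &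
  aeg u (fun p => box_measure (chain_distr p) A = (phi p g)%:E)].

Lemma represents_le A B g h : A `<=` B ->
  represents_measure A g -> represents_measure B h -> g <= h.
Proof.
move=> AB [g0 gu eg] [h0 hu eh].
apply: (@aeg_phi_le R _ _ u0 hG); [exact: ub01 | exact: ub01 |].
apply: aeg_imp (aeg_and eg eh) => p cp [e1 e2].
rewrite -lee_fin -[X in (X <= _)%E]e1 -[X in (_ <= X)%E]e2.
exact: le_outer_measure.
Qed.

Lemma represents_unique A g h :
  represents_measure A g -> represents_measure A h -> g = h.
Proof. by move=> hg hh; apply/eqP; rewrite eq_le !(@represents_le A A). Qed.

Lemma represents_orthant q : represents_measure (orthant (ratv R q)) (F (ratv R q)).
Proof.
split; [exact: (gd_ge0 hF) | exact: (gd_le hF) |].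
by apply: aeg_imp aeg_chain_distr => p cp dp; rewrite box_measure_orthant.
Qed.

(** The measures of the [A k] converge to that of the union, and their values [phi p (g k)] converge
    to [phi p s] for generic [p]. *)
Lemma represents_bigcup (A : nat -> set 'rV[R]_n) (g : nat -> G) s :
  (forall k, borel (A k)) -> (forall k, A k `<=` A k.+1) ->
  (forall k, represents_measure (A k) (g k)) ->
  (forall k, g k <= s) -> (forall w, (forall k, g k <= w) -> s <= w) ->
  represents_measure (\bigcup_k A k) s.
Proof.
move=> bA ndA hg gs sg.
have nd : nondecreasing_seq A.
  by apply/nondecreasing_seqP => k; apply/subsetPset; exact: ndA.
have s0 : 0 <= s by have [h _ _] := hg 0%N; apply: le_trans (gs 0%N).
have su : s <= u by apply: sg => k; have [] := hg k.
split => //.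
have e1 : aeg u (fun p => forall k, box_measure (chain_distr p) (A k) = (phi p (g k))%:E).
  by apply: aeg_all => k; have [] := hg k.
have e2 : aeg u (fun p => (fun k => phi p (g k)) @ \oo --> phi p s).
  apply: aeg_phi_sup => //; last 2 first.
  - exact: ub01.
  - move=> j k jk; apply: represents_le (hg j) (hg k).
    by apply/subsetPset; exact: nd.
  by move=> j; have [? ? _] := hg j; exact: ub01.
apply: aeg_imp (aeg_and aeg_chain_distr (aeg_and e1 e2)) => p cp [dp [h1 h2]].
have c1 := box_measure_cvg dp bA nd.
apply: (cvg_unique _ c1) => //; apply/fine_cvgP; split.
  by apply: nearW => k; rewrite /= h1.
apply: cvg_trans h2; apply: near_eq_cvg; apply: nearW => k.
by rewrite /= h1.
Qed.

Lemma represents_setD A B g h : borel A -> borel B -> A `<=` B ->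
  represents_measure A g -> represents_measure B h ->
  represents_measure (B `\` A) (h - g).
Proof.
move=> bA bB AB hg hh; have gh := represents_le AB hg hh.
have [[g0 gu eg] [h0 hu eh]] := (hg, hh).
split; first by rewrite lg_subr_ge0.
  by apply: le_trans hu; rewrite lg_leBlD -{1}(addr0 h) lg_leD2l.
have eB := @aeg_phiB R _ _ u0 _ _ (ub01 u0 h0 hu) (ub01 u0 g0 gu).
apply: aeg_imp (aeg_and aeg_chain_distr (aeg_and eg (aeg_and eh eB))) => p cp.
move=> [dp [e1 [e2 e3]]].
have bD : borel (B `\` A).
  exact: borelD.
have := box_measureU dp bA bD; rewrite setDIK => /(_ erefl).
rewrite setDUK// e1 e2 /phi e3.
case: (box_measure _ (B `\` A)) => [r|//|//].
by rewrite -EFinD => -[->]; rewrite addrC addKr.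
Qed.

Lemma represents_setT : represents_measure setT u.
Proof.
have -> : [set: 'rV[R]_n] = \bigcup_k orthant (ratv R (const_mx k%:R)).
  apply/esym; rewrite -subTset => s _.
  have [k hk] := row_bounded s; exists k => // j.
  by rewrite !mxE ratr_nat; apply: le_lt_trans (ler_norm _) (hk j).
apply: represents_bigcup (fun k => represents_orthant _) _ _.
- by move=> k; exact: borel_orthant.
- move=> k s hs i; apply: lt_le_trans (hs i) _.
  by rewrite !mxE ler_rat ler_nat.
- by move=> k; exact: (gd_le hF).
- move=> w hw; apply: (gd_top hF) => k; have := hw k.
  by rewrite (_ : ratv R _ = const_mx k%:R)//; apply/rowP => i; rewrite !mxE ratr_nat.
Qed.

Lemma borel_represented A : borel A -> exists g, represents_measure A g.
Proof.
move=> bA; suff [] : borel A /\ exists g, represents_measure A g by [].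
have L : lambda_system setT [set A | borel A /\ exists g, represents_measure A g].
  split=> //.
  - split; last by exists u; exact: represents_setT.
    exact: borelT.
  - move=> B C CB [bB [h hB]] [bC [g hC]]; split; last first.
      by exists (h - g); exact: represents_setD.
    exact: borelD.
  - move=> B ndB hB; have bB k : borel (B k) by case: (hB k).
    have /choice[g hg] : forall k, exists g, represents_measure (B k) g.
      by move=> k; case: (hB k).
    split.
      exact: borel_bigcup.
    (* Completeness of [G] supplies the candidate value on the union. *)
    have [||| s [sub slub]] := hG (A := range g).
    + exact: card_image_le.
    + by exists (g 0%N); exists 0%N.
    + by exists u => _ [k _ <-]; have [] := hg k.
    + exists s; apply: (@represents_bigcup B g) => //.
      * by move=> k; apply/subsetPset; exact: ndB.
      * by move=> k; apply: sub; exists k.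
      * by move=> w hw; apply: slub => _ [k _ <-].
suff : <<s @rational_orthants R n >> `<=`
    [set A | borel A /\ exists g, represents_measure A g].
  by apply; rewrite -borel_rational_orthants.
apply: (lambda_system_subset _ L) => //.
- move=> _ _ [q _ <-] [r _ <-]; exists (vmin q r) => //.
  exact: ratv_orthantI.
- move=> _ [q _ <-]; split; last by exists (F (ratv R q)); exact: represents_orthant.
  exact: borel_orthant.
Qed.

Theorem group_measure_exists : exists nu : set 'rV[R]_n -> G,
  [/\ forall A, borel A -> 0 <= nu A /\ nu A <= u,
      nu setT = u,
      forall A B, borel A -> borel B -> A `&` B = set0 -> nu (A `|` B) = nu A + nu B,
      forall (A : nat -> set 'rV[R]_n) w, (forall k, borel (A k)) ->
        (forall k, A k `<=` A k.+1) -> (forall k, nu (A k) <= w) -> nu (\bigcup_k A k) <= w &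
      forall t, nu (orthant t) = F t].
Proof.
have /choice[nu hnu] : forall A, exists g, borel A -> represents_measure A g.
  move=> A; have [bA|nA] := pselect (borel A).
    by have [g hg] := borel_represented bA; exists g.
  by exists 0.
have bT : borel [set: 'rV[R]_n] by exact: borelT.
have bO t : borel (@orthant R n t) by exact: borel_orthant.
have nu_cont (A : nat -> set 'rV[R]_n) w : (forall k, borel (A k)) ->
    (forall k, A k `<=` A k.+1) -> (forall k, nu (A k) <= w) -> nu (\bigcup_k A k) <= w.
  move=> bA ndA Aw.
  have [||| s [sub slub]] := hG (A := range (nu \o A)).
  - exact: card_image_le.
  - by exists (nu (A 0%N)); exists 0%N.
  - by exists w => _ [k _ <-]; exact: Aw.
  have bU : borel (\bigcup_k A k).
    exact: borel_bigcup.
  rewrite (@represents_unique _ (nu (\bigcup_k A k)) s (hnu _ bU)).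
    by apply: slub => _ [k _ <-]; exact: Aw.
  apply: (@represents_bigcup A (nu \o A)) => //.
  + by move=> k; exact: hnu.
  + by move=> k; apply: sub; exists k.
  + by move=> v hv; apply: slub => _ [k _ <-]; exact: hv.
exists nu; split => //.
- by move=> A bA; have [] := hnu A bA.
- by apply: represents_unique (hnu _ bT) represents_setT.
- move=> A B bA bB AB.
  have bU : borel (A `|` B).
    exact: borelU.
  have AU : A `<=` A `|` B by move=> s; left.
  have := represents_setD bA bU AU (hnu _ bA) (hnu _ bU).
  rewrite (_ : (A `|` B) `\` A = B); last first.
    apply/seteqP; split => [s [[//|//]]|s Bs]; split; first by right.
    by move=> As; have : (A `&` B) s by []; rewrite AB.
  by move=> hB; rewrite (represents_unique (hnu _ bB) hB) addrC subrK.
- move=> t.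
  (* For real [t], a rational point between [lower k t] and [t] transfers the equality known on
     rational orthants, by left continuity of both sides. *)
  have between (s s' : 'rV[R]_n) : (forall i, s 0 i < s' 0 i) ->
      exists q, forall i, s 0 i < ratv R q 0 i /\ ratv R q 0 i < s' 0 i.
    move=> ss'; have /choice[q hq] : forall i, exists q, s 0 i < ratr q /\ ratr q < s' 0 i.
      by move=> i; have [q] := rat_in_itvoo (ss' i); rewrite in_itv /= => /andP[? ?]; exists q.
    by exists (\row_i q i) => i; rewrite !mxE.
  have nuq q : nu (orthant (ratv R q)) = F (ratv R q).
    exact: represents_unique (hnu _ (bO _)) (represents_orthant q).
  have lt k := lower_ll k t.
  apply/eqP; rewrite eq_le; apply/andP; split.
    have -> : orthant t = \bigcup_k orthant (lower k t).
      apply/seteqP; split => [s hs|s [k _ hs] i]; last exact: lt_trans (hs i) (lt k i).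
      by have [k hk] := lower_approx hs; exists k.
    apply: nu_cont => //.
      move=> k s hs i; apply: lt_le_trans (hs i) _; rewrite !mxE lerD2l lerN2.
      by rewrite lef_pV2 ?posrE ?ltr0n// ler_nat.
    move=> k; have [q hq] := between _ _ (lt k).
    apply: (@le_trans _ _ (F (ratv R q))).
      rewrite -nuq; apply: represents_le (hnu _ (bO _)) (hnu _ (bO _)) => s hs i.
      by apply: lt_trans (hs i) _; have [] := hq i.
    by apply: (gd_mono hF) => i; apply: ltW; have [] := hq i.
  apply: (gd_left hF) => k; have [q hq] := between _ _ (lt k).
  apply: (@le_trans _ _ (F (ratv R q))).
    by apply: (gd_mono hF) => i; apply: ltW; have [] := hq i.
  rewrite -nuq; apply: represents_le (hnu _ (bO _)) (hnu _ (bO _)) => s hs i.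
  by apply: lt_trans (hs i) _; have [] := hq i.
Qed.

End GroupMeasure.

(** * Spectral resolutions *)

Section LexLGroup.
Variable G : lgroupType.
Implicit Types x y z : lexZ G.

(** With its lattice operations [lexZ G] is itself an [lgroupType], so the order lemmas above apply
    directly to [F]. *)
Definition lex_meet x y : lexZ G :=
  if x.1 < y.1 then x else if y.1 < x.1 then y else (x.1, lmeet x.2 y.2).
Definition lex_join x y : lexZ G :=
  if x.1 < y.1 then y else if y.1 < x.1 then x else (x.1, ljoin x.2 y.2).

Lemma le_lex_meet z x y : (z <= lex_meet x y) = (z <= x) && (z <= y).
Proof.
rewrite /lex_meet; case: (ltgtP x.1 y.1) => xy.
- apply/idP/andP => [zx|[//]]; split => //; apply: le_trans zx _.
  by rewrite lexZ_leE xy.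
- apply/idP/andP => [zy|[//]]; split => //; apply: le_trans zy _.
  by rewrite lexZ_leE xy.
- rewrite !lexZ_leE /= -xy le_lmeet.
  by case: (ltgtP z.1 x.1).
Qed.

Lemma lex_join_le x y z : (lex_join x y <= z) = (x <= z) && (y <= z).
Proof.
rewrite /lex_join; case: (ltgtP x.1 y.1) => xy.
- apply/idP/andP => [yz|[//]]; split => //; apply: le_trans yz.
  by rewrite lexZ_leE xy.
- apply/idP/andP => [xz|[//]]; split => //; apply: le_trans xz.
  by rewrite lexZ_leE xy.
- rewrite !lexZ_leE /= -xy ljoin_le.
  by case: (ltgtP x.1 z.1).
Qed.

Lemma lex_leD2l z x y : x <= y -> z + x <= z + y.
Proof. by rewrite !lexZ_leE /= ltrD2l (inj_eq (addrI _)) lg_leD2l. Qed.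

HB.instance Definition _ := POrderedZmodule_isLGroup.Build (lexZ G)
  le_lex_meet lex_join_le lex_leD2l.

Lemma lex_le1 x y : x <= y -> x.1 <= y.1.
Proof. by rewrite lexZ_leE => /orP[/ltW|/andP[/eqP->]]. Qed.

Lemma lex_le2 x y : x <= y -> x.1 = y.1 -> x.2 <= y.2.
Proof. by rewrite lexZ_leE => + xy; rewrite xy ltxx eqxx. Qed.

Lemma Gamma_cases (m : Gamma G) :
  ((val m).1 = 0 /\ 0 <= (val m).2) \/ ((val m).1 = 1 /\ (val m).2 <= 0).
Proof.
case: m => -[z g] /= /andP[]; rewrite !lexZ_leE /=.
have [z0|z0|<-] := ltgtP 0 z => //=; last by left.
have [z1|z1|->] := ltgtP z 1 => //=; last by right.
by exfalso; lia.
Qed.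

Lemma Gamma_exists (z : int) (g : G) : (z = 0 /\ 0 <= g) \/ (z = 1 /\ g <= 0) ->
  exists m : Gamma G, val m = (z, g).
Proof.
move=> zg; have H : 0 <= ((z, g) : lexZ G) <= lexZ_unit G.
  by rewrite !lexZ_leE /=; case: zg => -[-> ->].
by exists (MkGamma H).
Qed.

Lemma Gamma_le (m m' : Gamma G) : (m <= m') = (val m <= val m').
Proof. by []. Qed.

Lemma Rad'P (m : Gamma G) : Rad' m <-> (val m).1 = 1.
Proof.
split => [[g _ ->]//|m1]; have [[m0 _]|[_ g0]] := Gamma_cases m; first by rewrite m0 in m1.
exists (- (val m).2); first by rewrite lg_oppr_ge0.
by rewrite opprK -m1; case: (val m).
Qed.

Variables (T : Type) (F : T -> Gamma G) (S : set T) (m : Gamma G).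
Hypothesis Sm : supremums [set F s | s in S] m.

Lemma Gamma_sup_ge s : S s -> F s <= m.
Proof. by move=> Ss; apply: Sm.1; exists s. Qed.

(** If all values had integer part 0, lowering [m] by the [G]-part of any one of them would still
    give an upper bound. All values would then be 0, and so would [m]. *)
Lemma Gamma_sup_Rad' : (val m).1 = 1 -> exists2 s, S s & (val (F s)).1 = 1.
Proof.
move=> m1; apply: contrapT => hn.
have F0 s : S s -> (val (F s)).1 = 0 /\ 0 <= (val (F s)).2.
  by move=> Ss; have [//|[F1 _]] := Gamma_cases (F s); exfalso; apply: hn; exists s.
have F00 s : S s -> (val (F s)).2 <= 0.
  move=> Ss; have [[m0 _]|[_ m2]] := Gamma_cases m; first by rewrite m0 in m1.
  have [_ Fs0] := F0 s Ss.
  have [|w hw] := @Gamma_exists 1 ((val m).2 - (val (F s)).2).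
    right; split => //; rewrite lg_leBlD add0r; exact: le_trans m2 Fs0.
  have : m <= w.
    apply: Sm.2 => _ [r Sr <-]; rewrite Gamma_le lexZ_leE hw /=.
    by rewrite (F0 r Sr).1.
  rewrite Gamma_le => /lex_le2; rewrite hw /= m1 => /(_ erefl).
  by rewrite lg_leBrD -{2}(addr0 (val m).2) lg_leD2l.
have : m <= Gamma_bot G.
  apply: Sm.2 => _ [r Sr <-]; rewrite Gamma_le lexZ_leE /=.
  by rewrite (F0 r Sr).1 F00.
by rewrite Gamma_le => /lex_le1; rewrite m1.
Qed.

(** Suprema in [Gamma G] are tested only against elements of [Gamma G]; [w] is capped at 0 to yield
    one. *)
Lemma Gamma_sup1 w : (val m).1 = 1 ->
  (forall s, S s -> (val (F s)).1 = 1 -> (val (F s)).2 <= w) -> (val m).2 <= w.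
Proof.
move=> m1 hw; have /andP[w1 w2] := lmeet_le w 0.
have [|v hv] := @Gamma_exists 1 (lmeet w 0); first by right.
have : m <= v.
  apply: Sm.2 => _ [s Ss <-]; rewrite Gamma_le lexZ_leE hv /=.
  have [[-> //]|[F1 F2]] := Gamma_cases (F s).
  by rewrite F1 le_lmeet hw.
by rewrite Gamma_le => /lex_le2; rewrite hv m1 => /(_ erefl) /le_trans; apply.
Qed.

Lemma Gamma_sup0 w : S !=set0 -> (val m).1 = 0 ->
  (forall s, S s -> (val (F s)).2 <= w) -> (val m).2 <= w.
Proof.
move=> [s0 S0] m0 hw.
have F0 s : S s -> (val (F s)).1 = 0 /\ 0 <= (val (F s)).2.
  move=> Ss; have [//|[F1 _]] := Gamma_cases (F s).
  by have := Gamma_sup_ge Ss; rewrite Gamma_le => /lex_le1; rewrite F1 m0.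
have [|v hv] := @Gamma_exists 0 w.
  by left; split => //; apply: le_trans (F0 s0 S0).2 (hw _ S0).
have : m <= v.
  apply: Sm.2 => _ [s Ss <-]; rewrite Gamma_le lexZ_leE hv /=.
  by rewrite (F0 s Ss).1 /= hw.
by rewrite Gamma_le => /lex_le2; rewrite hv m0; exact.
Qed.

End LexLGroup.

Section VolumeBounds.
Variables (K : realDomainType) (n : nat) (G : lgroupType).
Implicit Types (f : 'rV[K]_n -> G) (a b s t : 'rV[K]_n) (l : seq 'I_n).

(** [P] contains every point that the expansion visits; each difference doubles the bound. *)
Lemma vol_bound f (P : set 'rV[K]_n) (m : G) a b l t :
  (forall s, P s -> - m <= f s /\ f s <= m) ->
  (forall s j, j \in l -> P s -> P (setc s j (a 0 j)) /\ P (setc s j (b 0 j))) ->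
  P t -> - (m *+ 2 ^ size l) <= vol f a b l t /\ vol f a b l t <= m *+ 2 ^ size l.
Proof.
move=> hf; elim: l t => [|i l IH] t hP Pt; first by rewrite mulr1n; exact: hf.
have hP' s j : j \in l -> P s -> P (setc s j (a 0 j)) /\ P (setc s j (b 0 j)).
  by move=> jl; apply: hP; rewrite inE jl orbT.
have [Pa Pb] := hP t i (mem_head _ _) Pt.
have [b1 b2] := IH _ hP' Pb; have [a1 a2] := IH _ hP' Pa.
rewrite vol_cons /= expnS mul2n -addnn mulrnDr opprD.
by split; apply: lg_leD => //; rewrite -lg_leN2 ?opprK.
Qed.

Lemma homo_coord f : (forall t j x, t 0 j <= x -> f t <= f (setc t j x)) ->
  forall s t, (forall i, s 0 i <= t 0 i) -> f s <= f t.
Proof.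
move=> hf s t st.
suff H l : f s <= f (\row_i if i \in (l : seq 'I_n) then t 0 i else s 0 i).
  have := H (enum 'I_n); rewrite (_ : \row_i _ = t)//.
  by apply/rowP => i; rewrite mxE mem_enum.
elim: l => [|j l IH]; first by rewrite (_ : \row_i _ = s)//; apply/rowP => i; rewrite mxE.
apply: le_trans IH _.
rewrite [X in _ <= f X](_ : _ = setc (\row_i if i \in l then t 0 i else s 0 i) j (t 0 j)).
  by apply: hf; rewrite mxE; case: (j \in l).
by apply/rowP => i; rewrite !mxE inE; case: eqP => // ->.
Qed.

End VolumeBounds.

(** * Supermodularity, characteristic point and boundedness *)

Section SpectralResolutionTheory.
Variables (R : realType) (n : nat) (G : lgroupType) (F : 'rV[R]_n -> Gamma G).
Hypothesis hF : spectral_resolution F.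
Implicit Types (a b c e s t : 'rV[R]_n) (i j : 'I_n) (l : seq 'I_n).

Let H t : lexZ G := val (F t).

Lemma sr_mono s t : (forall i, s 0 i <= t 0 i) -> H s <= H t.
Proof.
move=> st; suff : F s <= F t by rewrite Gamma_le.
apply: (sr_left hF s).2 => _ [r rs <-]; apply: (sr_left hF t).1; exists r => // i.
exact: lt_le_trans (rs i) (st i).
Qed.

Lemma sr_ge0 t : 0 <= H t.
Proof. by rewrite /H; case: (F t) => m /= /andP[]. Qed.

(** On a line lying entirely in [Rad'], each [(0, - g)] with [(1, g)] a value would be a lower
    bound. This forces [g = 0], so the infimum would be the top element. *)
Lemma sr_bot0 s i : exists r, (H (setc s i r)).1 = 0.
Proof.
apply: contrapT => hn.
have F1 r : (H (setc s i r)).1 = 1 /\ (H (setc s i r)).2 <= 0.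
  by have [[h _]|//] := Gamma_cases (F (setc s i r)); exfalso; apply: hn; exists r.
have F0 r : 0 <= (H (setc s i r)).2.
  have [|m hm] := @Gamma_exists G 0 (- (H (setc s i r)).2).
    by left; rewrite lg_oppr_ge0; split => //; case: (F1 r).
  have : m <= Gamma_bot G.
    apply: (sr_bot hF s i).2 => _ [q _ <-].
    by rewrite Gamma_le lexZ_leE hm -/(H (setc s i q)) (F1 q).1.
  by rewrite Gamma_le => /lex_le2; rewrite hm lg_oppr_le0; exact.
have : Gamma_top G <= Gamma_bot G.
  apply: (sr_bot hF s i).2 => _ [q _ <-].
  by rewrite Gamma_le lexZ_leE -/(H (setc s i q)) /= (F1 q).1 /= F0.
by rewrite Gamma_le => /lex_le1.
Qed.

Lemma sr_bot_lex s i (y : lexZ G) : (forall r, y <= H (setc s i r)) -> y <= 0.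
Proof.
move=> hy; have [r hr] := sr_bot0 s i.
have := lex_le1 (hy r); rewrite hr le_eqVlt => /orP[/eqP y0|y0]; last first.
  by rewrite lexZ_leE y0.
have /andP[y1 y2] := ljoin_ge y.2 0.
have [|m hm] := @Gamma_exists G 0 (ljoin y.2 0); first by left.
have : m <= Gamma_bot G.
  apply: (sr_bot hF s i).2 => _ [q _ <-]; rewrite Gamma_le lexZ_leE hm.
  rewrite -/(H (setc s i q)) /=.
  have [[h0 h2]|[-> //]] := Gamma_cases (F (setc s i q)).
  by rewrite [(H _).1]h0 ljoin_le h2 andbT /= (lex_le2 (hy q))// y0 [RHS]h0.
rewrite Gamma_le => /lex_le2; rewrite hm => /(_ erefl) ym.
by rewrite lexZ_leE y0 /=; exact: le_trans ym.
Qed.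

Definition vol_nonneg l := forall a b t, (forall i, a 0 i <= b 0 i) -> 0 <= vol H a b l t.

(** Letting the [j]-th lower corner tend to [-oo] removes the variable [j]. *)
Lemma vol_nonneg_rem l j : uniq l -> j \in l -> vol_nonneg l -> vol_nonneg (rem j l).
Proof.
move=> ul jl hl a b t ab.
have rj : j \notin rem j l by rewrite mem_rem_uniq// inE eqxx.
(* The subtracted face is a signed sum of values of [H] at points below [setc M j (t 0 j - k%:R)],
   hence at most [2 ^ size (rem j l)] copies of [y k], and [y] has infimum 0. *)
pose M := vmax b t.
pose y k := H (setc M j (t 0 j - k%:R)).
have yX (k : nat) : - vol H a b (rem j l) t <= y k *+ 2 ^ size (rem j l).
  have h1 : 0 <= vol H (setc a j (t 0 j - k%:R)) (setc b j (t 0 j)) l t.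
    apply: hl => i; rewrite !setcE; case: eqP => // _.
    by rewrite gerBl ler0n.
  have E s : vol H (setc a j (t 0 j - k%:R)) (setc b j (t 0 j)) (rem j l) s =
      vol H a b (rem j l) s.
    by apply: eq_vol => i il; rewrite setcE; case: eqP => // ij; move: rj; rewrite -{1}ij il.
  rewrite (vol_pull _ _ _ _ jl) !E !setcE eqxx setc_id lg_subr_ge0 in h1.
  apply: le_trans (_ : - vol H a b (rem j l) (setc t j (t 0 j - k%:R)) <= _).
    by rewrite lg_leN2.
  rewrite -lg_leN2 opprK.
  have [] // := @vol_bound _ _ _ H [set s | s 0 j = t 0 j - k%:R /\ forall i, s 0 i <= M 0 i]
    (y k) a b (rem j l) (setc t j (t 0 j - k%:R)).
  - move=> s [sj sM]; split.
      by apply: le_trans (sr_ge0 s); rewrite lg_oppr_le0 sr_ge0.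
    by apply: sr_mono => i; rewrite setcE; case: eqP => // ->; rewrite sj.
  - move=> s i il [sj sM].
    have ij : i != j by apply/eqP => E'; rewrite E' (negbTE rj) in il.
    split; split; rewrite ?setcE ?[j == i]eq_sym ?(negbTE ij)// => p; rewrite setcE;
      case: eqP => // ->; rewrite mxE le_max ?ab//.
    by rewrite lexx.
  - split; first by rewrite setcE eqxx.
    move=> i; rewrite setcE; case: eqP => [->|_]; rewrite mxE le_max ?lexx ?orbT//.
    by rewrite gerBl ler0n orbT.
rewrite -lg_oppr_le0; apply: (@inf_mulrn _ y (2 ^ size (rem j l))) yX.
- move=> k m km; apply: sr_mono => i; rewrite !setcE; case: eqP => // _.
  by rewrite lerD2l lerN2 ler_nat.
- move=> w hw; apply: (@sr_bot_lex M j) => r.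
  apply: le_trans (hw (Num.trunc `|t 0 j - r|).+1) _; apply: sr_mono => i.
  rewrite !setcE; case: eqP => // _; rewrite lerBlDr -lerBlDl.
  by apply: le_trans (ler_norm _) (ltW (truncnS_gt _)).
Qed.

Lemma vol_nonneg_filter (s : seq 'I_n) : vol_nonneg [seq k <- enum 'I_n | k \notin s].
Proof.
elim: s => [|j s IH].
  rewrite (_ : seq.filter _ _ = enum 'I_n); last by apply/all_filterP/allP.
  by move=> a b t ab; have h := @sr_volume _ _ _ _ hF a b ab t; refine h.
have [jl|jl] := boolP (j \in [seq k <- enum 'I_n | k \notin s]).
  have uL : uniq [seq k <- enum 'I_n | k \notin s] by apply: filter_uniq; exact: enum_uniq.
  have := vol_nonneg_rem uL jl IH; rewrite (rem_filter _ uL).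
  rewrite (_ : [seq k <- [seq k <- enum 'I_n | k \notin s] | predC1 j k] =
      [seq k <- enum 'I_n | k \notin j :: s])//.
  by rewrite -filter_predI; apply: eq_filter => k; rewrite /= inE negb_or.
rewrite (_ : seq.filter _ _ = [seq k <- enum 'I_n | k \notin s])//.
apply: eq_in_filter => k _; rewrite inE negb_or; case: eqP => // ->.
by move: jl; rewrite mem_filter mem_enum andbT => /negbTE ->.
Qed.

Lemma vol_nonneg_pair i j : i != j -> vol_nonneg [:: i; j].
Proof.
move=> ij a b t ab.
set L := [seq k <- enum 'I_n | k \notin [seq k <- enum 'I_n | k \notin [:: i; j]]].
have memL k : (k \in L) = (k \in [:: i; j]).
  by rewrite mem_filter mem_filter !mem_enum !andbT negbK.
have uL : uniq L by rewrite filter_uniq// enum_uniq.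
have iL : i \in L by rewrite memL mem_head.
have jL : j \in rem i L by rewrite mem_rem_uniq// !inE eq_sym ij memL !inE eqxx orbT.
have L0 : rem j (rem i L) = [::].
  case E : (rem j (rem i L)) => [//|k r].
  have : k \in rem j (rem i L) by rewrite E mem_head.
  move=> kji; have ki := mem_rem kji; have := mem_rem ki; rewrite memL !inE.
  case/orP => /eqP E'; first by rewrite E' mem_rem_uniqF in ki.
  by rewrite E' mem_rem_uniqF ?rem_uniq in kji.
have := vol_nonneg_filter [seq k <- enum 'I_n | k \notin [:: i; j]] t ab.
by rewrite -/L (vol_pull _ _ _ _ iL) !(vol_pull _ _ _ _ jL) L0.
Qed.

(** Increasing differences: the change caused by raising another coordinate [j] is the volume over
    the pair of coordinates. *)
Lemma increment_mono i (x y : R) s t : x <= y -> (forall j, s 0 j <= t 0 j) ->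
  H (setc s i y) - H (setc s i x) <= H (setc t i y) - H (setc t i x).
Proof.
move=> xy; apply: (@homo_coord _ _ _ (fun s => H (setc s i y) - H (setc s i x))).
move=> {}t j z tz; have [->|ij] := eqVneq i j; first by rewrite !setcc.
have ji : j != i by rewrite eq_sym.
have := @vol_nonneg_pair j i ji (setc t i x) (setc (setc t j z) i y) t.
rewrite !vol_cons /vol /= !setcE !eqxx (negbTE ji) setc_id lg_subr_ge0; apply.
by move=> k; rewrite !setcE; case: (k == i) => //; case: eqP => // ->.
Qed.

(** Raising to [c] the coordinates with [e 0 i < c 0 i] leads from [vmin c e] to [c] and from [e] to
    [vmax c e]. The second passage starts higher, so by increasing differences it gains at least as
    much. *)
Lemma sr_supermodular c e : H c + H e <= H (vmax c e) + H (vmin c e).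
Proof.
pose up (J : seq 'I_n) (x : 'rV[R]_n) : 'rV[R]_n := \row_i if i \in J then c 0 i else x 0 i.
have key J (x y : 'rV[R]_n) : uniq J -> (forall i, x 0 i <= y 0 i) ->
    (forall i, i \in J -> x 0 i = y 0 i /\ x 0 i <= c 0 i) ->
    H (up J x) - H x <= H (up J y) - H y.
  move=> + xy; elim: J => [|i J IH] /=.
    have E z : up [::] z = z by apply/rowP => i; rewrite mxE.
    by rewrite !E !subrr.
  move=> /andP[iJ uJ] hJ.
  have upE z : up (i :: J) z = setc (up J z) i (c 0 i).
    by apply/rowP => k; rewrite !mxE inE; case: eqP => // ->.
  have upi z : up J z = setc (up J z) i (z 0 i).
    by apply/rowP => k; rewrite !mxE; case: eqP => // ->; rewrite (negbTE iJ).
  have [xyi xc] := hJ i (mem_head _ _).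
  have h1 : H (up J x) - H x <= H (up J y) - H y.
    by apply: IH => // k kJ; apply: hJ; rewrite inE kJ orbT.
  have h2 : H (up (i :: J) x) - H (up J x) <= H (up (i :: J) y) - H (up J y).
    rewrite !upE {2}(upi x) {2}(upi y) -xyi; apply: increment_mono => // k.
    by rewrite !mxE; case: ifP.
  by have := lg_leD h2 h1; rewrite !addrA !subrK.
pose J := [seq i <- enum 'I_n | e 0 i < c 0 i].
have := key J (vmin c e) e; rewrite filter_uniq ?enum_uniq// => /(_ isT).
have -> : up J (vmin c e) = c.
  apply/rowP => i; rewrite !mxE mem_filter mem_enum andbT.
  by case: ifP => // /negbT; rewrite -leNgt => ce; rewrite min_l.
have -> : up J e = vmax c e.
  apply/rowP => i; rewrite !mxE mem_filter mem_enum andbT.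
  by case: (leP (c 0 i) (e 0 i)).
move=> h; have {}h : H c - H (vmin c e) <= H (vmax c e) - H e.
  apply: h => i; first by rewrite mxE ge_min lexx orbT.
  rewrite mem_filter => /andP[ec _]; rewrite mxE min_r ?ltW//; split => //; exact: ltW.
by rewrite lg_leBlD addrAC lg_leBrD in h; rewrite [X in _ <= X]addrC addrC addrC in h *.
Qed.

Lemma sr_Z t : (H t).1 = 0 \/ (H t).1 = 1.
Proof. by have [[->]|[->]] := Gamma_cases (F t); [left|right]. Qed.

Lemma sr_Z_le s t : (forall i, s 0 i <= t 0 i) -> (H s).1 = 1 -> (H t).1 = 1.
Proof.
move=> /sr_mono/lex_le1 + s1; rewrite s1.
by have [->|->] := sr_Z t.
Qed.

(** The integer part of supermodularity: two summands, each 0 or 1, have sum at least 2. *)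
Lemma sr_Z_inf s t : (H s).1 = 1 -> (H t).1 = 1 -> (H (vmin s t)).1 = 1.
Proof.
move=> s1 t1; have := lex_le1 (sr_supermodular s t).
have -> : (H s + H t).1 = (H s).1 + (H t).1 by [].
have -> : (H (vmax s t) + H (vmin s t)).1 = (H (vmax s t)).1 + (H (vmin s t)).1 by [].
rewrite s1 t1.
by have [->|->] := sr_Z (vmax s t); have [->|->] := sr_Z (vmin s t).
Qed.

Lemma sr_Z_left t : (H t).1 = 1 -> exists2 s, ll s t & (H s).1 = 1.
Proof. exact: Gamma_sup_Rad' (sr_left hF t). Qed.

Lemma sr_Z_top : exists s, (H s).1 = 1.
Proof. by have [//|s _ s1] := Gamma_sup_Rad' (sr_top hF); exists s. Qed.

Let coords i := [set t 0 i | t in F @^-1` @Rad' G].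

Lemma sr_coords_lbound i : has_lbound (coords i).
Proof.
have [s s1] := sr_Z_top; have [r hr] := sr_bot0 s i.
exists r => _ [t /= /Rad'P t1 <-]; rewrite leNgt; apply/negP => tr.
have : (H (setc s i r)).1 = 1.
  apply: sr_Z_le (sr_Z_inf s1 t1) => j; rewrite !mxE.
  by case: eqP => [->|_]; rewrite ge_min ?lexx ?(ltW tr) ?orbT.
by rewrite hr.
Qed.

(** Left continuity makes the inequalities strict. Conversely, one point with integer part 1 is
    chosen below [t] in each coordinate, and the infimum of these finitely many points still has
    integer part 1. *)
Lemma char_point_lt t : (H t).1 = 1 <-> ll (char_point F) t.
Proof.
split => [t1 i|lt].
  have [s st s1] := sr_Z_left t1; apply: le_lt_trans (st i).
  rewrite mxE; apply: ge_inf; first exact: sr_coords_lbound.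
  by exists s => //; apply/Rad'P.
suff [s [s1 st]] : exists s, (H s).1 = 1 /\ forall i, i \in enum 'I_n -> s 0 i < t 0 i.
  by apply: sr_Z_le s1 => i; apply/ltW/st; rewrite mem_enum.
elim: (enum 'I_n) => [|i l [s [s1 st]]].
  by have [s s1] := sr_Z_top; exists s.
have ne : coords i !=set0.
  by have [r r1] := sr_Z_top; exists (r 0 i), r => //; apply/Rad'P.
have ilt : inf (coords i) < t 0 i by have h := lt i; rewrite mxE in h; exact: h.
have [_ [r /= /Rad'P r1 <-] ri] := inf_lt ne ilt.
exists (vmin s r); split; first exact: sr_Z_inf.
move=> j; rewrite inE mxE gt_min => /orP[/eqP->|jl]; first by rewrite ri orbT.
by rewrite st.
Qed.

(** Condition [sr_char] gives the lower bound [- g0] on the orthant. A point [t] off it has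
    [t 0 i <= t0 0 i] for some [i]; supermodularity for [t] and the fixed point [e] has equal
    integer parts on both sides, so the [G]-parts compare, and [vmin t e] lies below
    [setc e i (t0 0 i)]. The sum [S] makes the bound independent of [i]. *)
Lemma sr_bounded : exists K : G, [/\ 0 <= K,
  forall t, (H t).1 = 0 -> (H t).2 <= K & forall t, (H t).1 = 1 -> - K <= (H t).2].
Proof.
have [m [mlb _] /Rad'P m1] := sr_char hF.
pose t0 := char_point F; pose e : 'rV[R]_n := \row_i (t0 0 i + 1).
pose h i := (H (setc e i (t0 0 i))).2.
have Ze : (H e).1 = 1 by apply/char_point_lt => i; rewrite [X in _ < X]mxE ltrDl.
have Z0 i : (H (setc e i (t0 0 i))).1 = 0.
  have [//|/char_point_lt/(_ i)] := sr_Z (setc e i (t0 0 i)).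
  by rewrite setcE eqxx ltxx.
have h0 i : 0 <= h i.
  by have := sr_ge0 (setc e i (t0 0 i)) => /lex_le2; apply; rewrite Z0.
pose g0 := - (val m).2.
have g00 : 0 <= g0.
  by rewrite lg_oppr_ge0; have [[m0 _]|[]//] := Gamma_cases m; rewrite m0 in m1.
have Hge t : (H t).1 = 1 -> - g0 <= (H t).2.
  move=> t1; rewrite opprK.
  have : m <= F t by apply: mlb; exists t => //; exact/char_point_lt.
  by rewrite Gamma_le => /lex_le2; apply; rewrite m1 [RHS]t1.
have sum_ge i (r : seq 'I_n) : 0 <= \sum_(j <- r) h j /\ (i \in r -> h i <= \sum_(j <- r) h j).
  elim: r => [|j r [IH1 IH2]]; first by rewrite big_nil.
  rewrite big_cons; split; first exact: lg_addr_ge0.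
  rewrite inE => /orP[/eqP->|/IH2 ir]; first by rewrite -{1}(addr0 (h j)) lg_leD2l.
  by rewrite -(add0r (h i)); exact: lg_leD.
pose S := \sum_(j <- enum 'I_n) h j.
have S0 : 0 <= S.
  rewrite /S; elim: (enum 'I_n) => [|j r IH]; first by rewrite big_nil.
  by rewrite big_cons; exact: lg_addr_ge0.
exists (g0 + S); split; first exact: lg_addr_ge0.
- move=> t tz.
  have [i ti] : exists i, t 0 i <= t0 0 i.
    apply: contrapT => hn; have : (H t).1 = 1.
      by apply/char_point_lt => i; rewrite ltNge; apply/negP => ti; apply: hn; exists i.
    by rewrite tz.
  have Zmax : (H (vmax t e)).1 = 1.
    by apply: sr_Z_le Ze => j; rewrite [X in _ <= X]mxE le_max lexx orbT.
  have lemin j : vmin t e 0 j <= setc e i (t0 0 i) 0 j.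
    by rewrite [leLHS]mxE setcE; case: eqP => [->|_]; rewrite ge_min ?ti ?lexx ?orbT.
  have Zmin : (H (vmin t e)).1 = 0.
    have [//|/(sr_Z_le lemin)] := sr_Z (vmin t e); by rewrite Z0.
  have sm := lex_le2 (sr_supermodular t e).
  have {}sm : (H t).2 + (H e).2 <= (H (vmax t e)).2 + (H (vmin t e)).2.
    apply: sm.
    have -> : (H t + H e).1 = (H t).1 + (H e).1 by [].
    have -> : (H (vmax t e) + H (vmin t e)).1 = (H (vmax t e)).1 + (H (vmin t e)).1 by [].
    by rewrite tz Ze Zmax Zmin.
  have max0 : (H (vmax t e)).2 <= 0.
    by have [[]|[]//] := Gamma_cases (F (vmax t e)); rewrite [X in X = 0]Zmax.
  have minh : (H (vmin t e)).2 <= S.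
    apply: (@le_trans _ _ (h i)); last by apply: (sum_ge i _).2; rewrite mem_enum.
    by apply: lex_le2 (sr_mono lemin) _; rewrite Zmin Z0.
  have sm2 := le_trans sm (lg_leD max0 minh); rewrite add0r in sm2.
  rewrite -lg_leBrD in sm2; apply: le_trans sm2 _.
  by rewrite addrC lg_leD2r -[leRHS]opprK lg_leN2 Hge.
- move=> t t1; apply: le_trans (Hge t t1); rewrite lg_leN2.
  by rewrite -{1}(addr0 g0) lg_leD2l.
Qed.

End SpectralResolutionTheory.

(** * The distribution function with added mass *)

Section ShiftedDistribution.
Variables (R : realType) (n : nat) (G : lgroupType) (F : 'rV[R]_n -> Gamma G).
Hypothesis hF : spectral_resolution F.
Implicit Types (s t : 'rV[R]_n) (u w : G).

Let H t : lexZ G := val (F t).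

Let H_cases t : ((H t).1 = 0 /\ 0 <= (H t).2) \/ ((H t).1 = 1 /\ (H t).2 <= 0).
Proof. exact: Gamma_cases. Qed.

(** Puts an additional mass [u] at the characteristic point. *)
Definition shifted u t : G := (val (F t)).2 + u *~ (val (F t)).1.

Let shifted0 u t : (H t).1 = 0 -> shifted u t = (H t).2.
Proof. by move=> h; rewrite /shifted [(val (F t)).1]h mulr0z addr0. Qed.

Let shifted1 u t : (H t).1 = 1 -> shifted u t = (H t).2 + u.
Proof. by move=> h; rewrite /shifted [(val (F t)).1]h mulr1z. Qed.

Lemma vol_shifted u a b l t : vol (shifted u) a b l t =
  (vol H a b l t).2 + u *~ (vol H a b l t).1.
Proof.
rewrite (volD (fun t => (H t).2) (fun t => u *~ (H t).1)); congr (_ + _).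
  by rewrite -(@vol_map _ _ _ _ (fun x : lexZ G => x.2) H).
rewrite -(@vol_map _ _ _ _ (fun x : lexZ G => u *~ x.1) H)// => l' t1 t2.
by rewrite -mulrzBr.
Qed.

Lemma group_distribution_shifted : exists u, group_distribution u (shifted u).
Proof.
have [K [K0 KZ0 KZ1]] := sr_bounded hF.
(* Two copies of [K] cover the jump of the integer part from 0 to 1; [2 ^ n] copies cover the
   [G]-part of a volume with positive integer part, a signed sum of [2 ^ n] values between [- K] and
   [K]. *)
pose u := K *+ (2 ^ n).+2; exists u.
have Ku m : (m <= (2 ^ n).+2)%N -> K *+ m <= u by move=> hm; exact: lg_leMnr.
have u0 : 0 <= u by exact: lg_mulrn_ge0.
have mono s t : (forall i, s 0 i <= t 0 i) -> shifted u s <= shifted u t.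
  move=> st; have := sr_mono hF st; rewrite -/(H s) -/(H t) => Hst.
  have [[s1 s2]|[s1 s2]] := H_cases s; have [[t1 t2]|[t1 t2]] := H_cases t.
  - by rewrite !shifted0//; apply: lex_le2 Hst _; rewrite s1 t1.
  - rewrite shifted0// shifted1//; apply: le_trans (KZ0 s s1) _.
    rewrite -lg_leBlD; apply: le_trans (KZ1 t t1).
    by rewrite lg_leBlD addrC lg_leBrD -mulr2n Ku.
  - by have := lex_le1 Hst; rewrite s1 t1.
  - by rewrite !shifted1// lg_leD2r; apply: lex_le2 Hst _; rewrite s1 t1.
split=> //.
- move=> a b t ab; have /= v0 := sr_volume hF ab t.
  rewrite vol_shifted; change (volume F a b t) with (vol H a b (enum 'I_n) t) in v0.
  set v := vol H a b (enum 'I_n) t in v0 *.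
  have v2 : - (K *+ 2 ^ n) <= v.2.
    rewrite /v (@vol_map _ _ _ _ (fun x : lexZ G => x.2) H)//.
    have [] // := @vol_bound _ _ _ ((fun x : lexZ G => x.2) \o H) setT K a b (enum 'I_n) t.
      move=> s _ /=; have [[s1 s2]|[s1 s2]] := H_cases s.
        by split; [apply: le_trans s2; rewrite lg_oppr_le0 | exact: KZ0].
      by split; [exact: KZ1 | apply: le_trans s2 _].
    by rewrite size_enum_ord.
  have := v0; rewrite lexZ_leE /= => /orP[v1|/andP[/eqP<- h]]; last first.
    by rewrite mulr0z addr0.
  have : u *~ 1 <= u *~ v.1 by apply: lg_leMz => //; lia.
  rewrite mulr1z => uv; have := lg_leD v2 (le_trans (Ku (2 ^ n)%N _) uv).
  by rewrite addrC subrr; apply; rewrite ltnW// ltnW.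
- move=> t; have [[t1 t2]|[t1 t2]] := H_cases t; first by rewrite shifted0.
  rewrite shifted1// -lg_leBlD add0r; apply: le_trans (KZ1 t t1).
  by rewrite lg_leN2 -[K]mulr1n Ku.
- move=> t; have [[t1 t2]|[t1 t2]] := H_cases t.
    by rewrite shifted0//; apply: le_trans (KZ0 t t1) _; rewrite -[K]mulr1n Ku.
  by rewrite shifted1// -[leRHS]add0r lg_leD2r.
- move=> t w hw; have [[t1 t2]|[t1 t2]] := H_cases t.
    rewrite shifted0//; apply: (Gamma_sup0 (sr_left hF t)) => //.
      by exists (lower 0 t); exact: lower_ll.
    move=> s st; have [k hk] := lower_approx st.
    have {}hk i := ltW (hk i); have [[k1 k2]|[k1 k2]] := H_cases (lower k t); last first.
      by have := sr_Z_le hF (fun i => ltW (lower_ll k t i)) k1; rewrite -/(H t) t1.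
    apply: le_trans (hw k); rewrite shifted0//.
    have Hsk := sr_mono hF hk; apply: (lex_le2 Hsk).
    have := lex_le1 Hsk; have [[s1 _]|[s1 _]] := H_cases s; last first.
      by rewrite [(val (F s)).1]s1 [(val (F (lower k t))).1]k1.
    by rewrite [LHS]s1 [RHS]k1.
  rewrite shifted1// -lg_leBrD.
  apply: (Gamma_sup1 (sr_left hF t)) => // s st s1; have [k hk] := lower_approx st.
  have {}hk i := ltW (hk i); have Hsk := sr_mono hF hk.
  have k1 : (H (lower k t)).1 = 1 by apply: sr_Z_le hk s1.
  have := hw k; rewrite shifted1// -lg_leBrD; apply: le_trans.
  by apply: (lex_le2 Hsk); rewrite [RHS]k1.
- move=> t i w hw; have [r r0] := sr_bot0 hF t i.
  suff : ((0 : int, w) : lexZ G) <= 0 by move=> /lex_le2; exact.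
  apply: (sr_bot_lex hF (s := t) (i := i)) => q.
  pose k := maxn (Num.trunc `|r|).+1 (Num.trunc `|q|).+1.
  have kle (z : R) : (Num.trunc `|z| < k)%N -> - k%:R <= z.
    move=> hz; rewrite lerNl -normrN in hz *; apply: le_trans (ler_norm _) _.
    by apply: le_trans (ltW (truncnS_gt _)) _; rewrite ler_nat.
  have kr : - k%:R <= r by apply: kle; rewrite leq_max leqnn.
  have kq : - k%:R <= q by apply: kle; rewrite leq_max leqnn orbT.
  have mon z : - k%:R <= z -> H (setc t i (- k%:R)) <= H (setc t i z).
    by move=> kz; apply: (sr_mono hF) => j; rewrite !setcE; case: (j == i).
  have Zk : (H (setc t i (- k%:R))).1 = 0.
    have := lex_le1 (mon _ kr); rewrite [X in _ <= X]r0.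
    by have [[-> //]|[-> //]] := H_cases (setc t i (- k%:R)).
  apply: le_trans (mon _ kq); rewrite lexZ_leE /= Zk eqxx /=.
  by have := hw k; rewrite shifted0.
- move=> w hw; suff : (val (Gamma_top G)).2 <= w - u by rewrite /= lg_leBrD add0r.
  apply: (Gamma_sup1 (sr_top hF)) => // s _ s1.
  have [k hk] := row_bounded s.
  have sk i : s 0 i <= (const_mx k%:R : 'rV[R]_n) 0 i.
    by rewrite mxE; apply: le_trans (ler_norm _) (ltW (hk i)).
  have k1 := sr_Z_le hF sk s1.
  have := hw k; rewrite shifted1// lg_leBrD; apply: le_trans.
  by rewrite lg_leD2r; apply: (lex_le2 (sr_mono hF sk)); rewrite [RHS]k1.
Qed.

End ShiftedDistribution.

(** * Uniqueness and construction of observables *)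

Section Observables.
Variables (R : realType) (n : nat) (G : lgroupType).
Implicit Types (x y : set 'rV[R]_n -> Gamma G) (A B : set 'rV[R]_n).

Lemma observable_add x A B : observable x -> borel A -> borel B -> A `&` B = set0 ->
  val (x (A `|` B)) = val (x A) + val (x B).
Proof.
move=> ox bA bB AB; have := obs_add ox bA bB AB; rewrite /Gamma_padd.
by case: insubP => // z _ <- [->].
Qed.

(** A Dynkin argument on rational orthants: proper differences are handled by cancellation in
    [lexZ G], increasing unions by uniqueness of suprema. *)
Lemma observable_unique x y : observable x -> observable y ->
  (forall t, x (orthant t) = y (orthant t)) -> forall A, borel A -> x A = y A.
Proof.
move=> ox oy xy A bA.
have L : lambda_system setT [set A | borel A /\ x A = y A].
  split => //.
  - split; last by rewrite (obs_top ox) (obs_top oy).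
    exact: borelT.
  - move=> B C CB [bB eB] [bC eC].
    have bD : borel (B `\` C).
      exact: borelD.
    split => //; apply: val_inj.
    have CD : C `&` (B `\` C) = set0 by rewrite setDIK.
    have := observable_add ox bC bD CD; have := observable_add oy bC bD CD.
    by rewrite setDUK// eB eC => -> /addrI.
  - move=> B ndB hB; have bB k : borel (B k) by case: (hB k).
    have BB k : B k `<=` B k.+1 by apply/subsetPset; exact: ndB.
    split.
      exact: borel_bigcup.
    have E : [set x (B k) | k in [set: nat]] = [set y (B k) | k in [set: nat]].
      by apply: eq_imagel => k _; case: (hB k).
    have [x1 x2] := obs_sup ox bB BB; have [y1 y2] := obs_sup oy bB BB.
    apply/eqP; rewrite eq_le; apply/andP; split; [apply: x2|apply: y2].
      by rewrite E.
    by rewrite -E.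
suff : <<s @rational_orthants R n >> `<=` [set A | borel A /\ x A = y A].
  by move=> /(_ A)[]//; rewrite -borel_rational_orthants.
apply: (lambda_system_subset _ L) => //.
- move=> _ _ [q _ <-] [r _ <-]; exists (vmin q r) => //.
  exact: ratv_orthantI.
- move=> _ [q _ <-]; split => //.
  exact: borel_orthant.
Qed.

Lemma observable_of_measure (p : 'rV[R]_n) (u : G) (nu : set 'rV[R]_n -> G) :
  (forall A, borel A -> 0 <= nu A /\ nu A <= u) -> nu setT = u ->
  (forall A B, borel A -> borel B -> A `&` B = set0 -> nu (A `|` B) = nu A + nu B) ->
  (forall (A : nat -> set 'rV[R]_n) w, (forall k, borel (A k)) ->
        (forall k, A k `<=` A k.+1) -> (forall k, nu (A k) <= w) -> nu (\bigcup_k A k) <= w) ->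
  exists x, observable x /\ forall A, borel A ->
    (A p -> val (x A) = (1, nu A - u)) /\ (~ A p -> val (x A) = (0, nu A)).
Proof.
move=> nu01 nuT nuU nusup.
have /choice[x hx] : forall A, exists m : Gamma G, borel A ->
    (A p -> val m = (1, nu A - u)) /\ (~ A p -> val m = (0, nu A)).
  move=> A; have [bA|nA] := pselect (borel A); last by exists (Gamma_bot G).
  have [A0 A1] := nu01 A bA.
  have [Ap|nAp] := pselect (A p).
    have [|m hm] := @Gamma_exists G 1 (nu A - u); last by exists m.
    by right; rewrite lg_leBlD add0r.
  have [|m hm] := @Gamma_exists G 0 (nu A); last by exists m.
  by left.
exists x; split => //.
have bT : borel [set: 'rV[R]_n] by exact: borelT.
split.
- by apply: val_inj; rewrite (hx _ bT).1//= nuT subrr.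
- move=> A B bA bB AB.
  have bU : borel (A `|` B).
    exact: borelU.
  suff e : val (x A) + val (x B) = val (x (A `|` B)) by rewrite /Gamma_padd e valK.
  have pairD (a b : int * G) : (a : lexZ G) + b = ((a.1 + b.1, a.2 + b.2) : lexZ G) by [].
  have [Ap|nAp] := pselect (A p).
    have nBp : ~ B p by move=> Bp; have : (A `&` B) p by []; rewrite AB.
    rewrite (hx _ bA).1// (hx _ bB).2// (hx _ bU).1; last by left.
    by rewrite pairD /= nuU// addr0 addrAC.
  have [Bp|nBp] := pselect (B p).
    rewrite (hx _ bA).2// (hx _ bB).1// (hx _ bU).1; last by right.
    by rewrite pairD /= nuU// add0r addrA.
  rewrite (hx _ bA).2// (hx _ bB).2// (hx _ bU).2; last by case.
  by rewrite pairD /= nuU// addr0.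
- move=> A bA ndA.
  have bU : borel (\bigcup_k A k).
    exact: borel_bigcup.
  have nu_le B C : borel B -> borel C -> B `<=` C -> nu B <= nu C.
    move=> bB bC BC; have bD : borel (C `\` B).
      exact: borelD.
    rewrite -(setDUK BC) nuU ?setDIK// -{1}(addr0 (nu B)) lg_leD2l.
    by case: (nu01 _ bD).
  have AU k : A k `<=` \bigcup_k A k by move=> s ?; exists k.
  have Ale k m : (k <= m)%N -> A k `<=` A m.
    move=> km; rewrite -(subnKC km); elim: (m - k)%N => [|d IH]; first by rewrite addn0.
    by rewrite addnS; apply: subset_trans (ndA _).
  split.
    move=> _ [k _ <-]; rewrite Gamma_le.
    have [Ap|nAp] := pselect (A k p).
      rewrite (hx _ (bA k)).1// (hx _ bU).1; last exact: AU Ap.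
      by rewrite lexZ_leE /= lg_leD2r nu_le.
    rewrite (hx _ (bA k)).2//; have [Up|nUp] := pselect ((\bigcup_k A k) p).
      by rewrite (hx _ bU).1// lexZ_leE.
    by rewrite (hx _ bU).2// lexZ_leE /= nu_le.
  move=> m hm; have xm k : val (x (A k)) <= val m by rewrite -Gamma_le; apply: hm; exists k.
  rewrite Gamma_le; have [[k _ Akp]|nUp] := pselect ((\bigcup_k A k) p).
    rewrite (hx _ bU).1; last exact: AU Akp.
    have m1 : (val m).1 = 1.
      have := lex_le1 (xm k); rewrite (hx _ (bA k)).1//=.
      by have [[->]|[->]] := Gamma_cases m.
    rewrite lexZ_leE /= m1 /= lg_leBlD; apply: nusup => // j.
    (* From index [k] on the sets contain [p], so only there does the bound [m] constrain the
       [G]-part. *)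
    apply: (@le_trans _ _ (nu (A (maxn k j)))).
      by apply: nu_le => //; apply: Ale; exact: leq_maxr.
    rewrite -lg_leBlD; have h := lex_le2 (xm (maxn k j)).
    have Ap : A (maxn k j) p by apply: Ale Akp; exact: leq_maxl.
    by rewrite (hx _ (bA _)).1//= in h; apply: h; rewrite m1.
  rewrite (hx _ bU).2// lexZ_leE /=; have [[m0 m2]|[-> //]] := Gamma_cases m.
  rewrite m0 /=; apply: nusup => // j.
  have h := lex_le2 (xm j); rewrite (hx _ (bA _)).2//= in h; last by move=> /AU.
  by apply: h; rewrite m0.
Qed.

End Observables.

Theorem theorem3p4 (R : realType) (n : nat) (hn : (1 <= n)%N)
    (G : lgroupType) (hG : dedekind_sigma_complete G)
    (F : 'rV[R]_n -> Gamma G) (hF : spectral_resolution F) :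
  let represents (x : set 'rV[R]_n -> Gamma G) :=
    observable x /\
    forall t : 'rV[R]_n, x [set s : 'rV[R]_n | forall i : 'I_n, s 0 i < t 0 i] = F t in
  exists2 x : set 'rV[R]_n -> Gamma G, represents x &
    forall y : set 'rV[R]_n -> Gamma G, represents y ->
      forall A : set 'rV[R]_n, borel A -> y A = x A.
Proof.
move=> represents.
have [u gu] := group_distribution_shifted hF.
have [nu [nu01 nuT nuU nusup nuO]] := group_measure_exists hn hG gu.
have [x [ox hx]] := observable_of_measure (char_point F) nu01 nuT nuU nusup.
have xF t : x (orthant t) = F t.
  have bO : borel (orthant t) by exact: borel_orthant.
  apply: val_inj; have [h1 h0] := hx _ bO.
  have pairE (v : lexZ G) : v = (v.1, v.2) by case: v.
  (* The orthant of [t] contains the characteristic point exactly when [F t] has integer part 1, so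
     the mass [u] is removed exactly where it was added. *)
  have [Op|nOp] := pselect (orthant t (char_point F)).
    have t1 := (char_point_lt hF t).2 Op.
    by rewrite h1// nuO /shifted t1 mulr1z addrK -t1 -pairE.
  have [t0|t1] := sr_Z F t; last by exfalso; apply: nOp; exact: (char_point_lt hF t).1.
  by rewrite h0// nuO /shifted t0 mulr0z addr0 -t0 -pairE.
exists x => // y [oy yF] A bA.
by apply: observable_unique => // t; rewrite xF; exact: yF.
Qed.
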